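(* Let $n\ge2$. The isomorphism classes of $4n$-dimensional nilpotent almost abelian Lie algebras $\mathfrak{g}_A=\mathbb{R}e_0\ltimes_A\mathbb{R}^{4n-1}$ which admit a hypercomplex structure and satisfy $\dim(\ker A)<4(n-1)$ are parametrized by the set of matrices $\tilde\Sigma_{n-1}\subset\mathfrak{gl}(4n-1,\mathbb{R})$; that is, $M\mapsto[\mathfrak{g}_M]$ is a bijection from $\tilde\Sigma_{n-1}$ onto the set of these isomorphism classes. If $\mathfrak{g}_A=\mathbb{R}e_0\ltimes_A\mathbb{R}^{4n-1}$ is nilpotent, admits a hypercomplex structure and $\dim(\ker A)=4(n-1)$, then $\mathfrak{g}_A$ is isomorphic to $\mathfrak{g}_{N(n-1)}$.
   Context: A hypercomplex structure on a real Lie algebra $\mathfrak{g}$ is a triple $J_1,J_2,J_3$ of endomorphisms with $J_\alpha^2=-I$, $J_1J_2=-J_2J_1=J_3$ and $[x,y]+J_\alpha([J_\alpha x,y]+[x,J_\alpha y])-[J_\alpha x,J_\alpha y]=0$ for all $x,y$ and $\alpha$. For $M\in\mathfrak{gl}(d,\mathbb{R})$, $\mathfrak{g}_M=\mathbb{R}e_0\ltimes_M\mathbb{R}^d$ is the Lie algebra with $\mathbb{R}^d$ an abelian ideal and $[e_0,v]=Mv$. $M_1\oplus M_2$ denotes the block diagonal matrix, $M^{\oplus p}$ denotes $p$ copies, $0_k$, $I_k$ are the zero and identity $k\times k$ matrices. Let $U=\begin{bmatrix}0&0&0\\1&0&0\\0&1&0\\0&0&1\end{bmatrix}$, and let $\mathbb{J}_m\in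 M_{4m}(\mathbb{R})$ be the matrix of $4\times4$ blocks with $I_4$ on the block subdiagonal and $0_4$ elsewhere. $\Sigma_{n-1}$ is the set of tuples $(r,m_1,\dots,m_r,p_1,\dots,p_r,s)$ of integers with $r>0$, $m_1>\dots>m_r\ge2$, $s\ge0$, $p_k>0$ and $\sum_{i=1}^r m_ip_i+s=n-1$. For such a tuple put $$N_\ell=\begin{bmatrix}0_3&0\\ \begin{smallmatrix}U\\0\end{smallmatrix}&\mathbb{J}_{m_\ell}\end{bmatrix}\oplus(\mathbb{J}_{m_\ell})^{\oplus(p_\ell-1)}\ (1\le\ell\le r),\qquad N(s)=\begin{bmatrix}0_3&0\\ \begin{smallmatrix}U\\0\end{smallmatrix}&0_{4s}\end{bmatrix}\ (s>0),$$ where $\begin{smallmatrix}U\\0\end{smallmatrix}$ is $U$ on top of a zero matrix with $4(m_\ell-1)$, respectively $4(s-1)$, rows, and $$A_0=0_3\oplus(\mathbb{J}_{m_1})^{\oplus p_1}\oplus\dots\oplus(\mathbb{J}_{m_r})^{\oplus p_r}\oplus0_{4s},$$ $$A_\ell=\bigoplus_{i=1}^{\ell-1}(\mathbb{J}_{m_i})^{\oplus p_i}\oplus N_\ell\oplus\bigoplus_{i=\ell+1}^{r}(\mathbb{J}_{m_i})^{\oplus p_i}\oplus0_{4s}\quad(1\le\ell\le r),$$ $$A_{r+1}=(\mathbb{J}_{m_1})^{\oplus p_1}\oplus\dots\oplus(\mathbb{J}_{m_r})^{\oplus p_r}\oplus N(s)\quad(\text{only for }s>0).$$ Thus each tuple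 yields $r+2-\delta_{s,0}$ matrices ($\delta$ the Kronecker delta). $\tilde\Sigma_{n-1}$ is the set of all these matrices arising from all tuples in $\Sigma_{n-1}$. *)

(* Defs.v *)
From HB Require Import structures.
From mathcomp Require Import all_boot all_order all_algebra.
From mathcomp Require Import boolp classical_sets functions reals.

Set Implicit Arguments.
Unset Strict Implicit.
Unset Printing Implicit Defensive.

Import GRing.Theory.

Local Open Scope classical_set_scope.
Local Open Scope ring_scope.

Record lieAlgebra (R : realType) := LieAlgebra {
  lie_sort :> vectType R;
  bracket : lie_sort -> lie_sort -> lie_sort;
  bracket_linearl : forall y, linear (bracket ^~ y);
  bracket_linearr : forall x, linear (bracket x);
  bracket_alt : forall x, bracket x x = 0;
  bracket_jacobi : forall x y z,
    bracket x (bracket y z) + bracket y (bracket z x)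
      + bracket z (bracket x y) = 0 }.

Section LieAlgebraNotions.
Variable R : realType.
Implicit Types L : lieAlgebra R.

Definition lie_isomorphic L1 L2 : Prop :=
  exists f : 'Hom(L1, L2),
    bijective f /\ forall x y, f (bracket x y) = bracket (f x) (f y).

(* By bilinearity, the brackets of basis vectors span [U, V]. *)
Definition bracketv L (U V : {vspace L}) : {vspace L} :=
  <<[seq bracket x y | x <- vbasis U, y <- vbasis V]>>%VS.

Fixpoint lower_central L (k : nat) : {vspace L} :=
  if k is k'.+1 then bracketv fullv (lower_central L k') else fullv.

Definition lie_nilpotent L : Prop := exists k, lower_central L k = 0%VS.

Definition integrable L (J : 'End(L)) : Prop :=
  forall x y : L,
    bracket x y + J (bracket (J x) y + bracket x (J y))
      - bracket (J x) (J y) = 0.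

Definition hypercomplex L (J1 J2 J3 : 'End(L)) : Prop :=
  [/\ [/\ (J1 \o J1)%VF = - \1%VF, (J2 \o J2)%VF = - \1%VF
        & (J3 \o J3)%VF = - \1%VF],
      (J1 \o J2)%VF = J3, - (J2 \o J1)%VF = J3
    & [/\ integrable J1, integrable J2 & integrable J3]].

Definition admits_hypercomplex L : Prop :=
  exists J1 J2 J3 : 'End(L), hypercomplex J1 J2 J3.

End LieAlgebraNotions.

Section AlmostAbelian.
Variables (R : realType) (d : nat) (M : 'M[R]_d).

(* The pair (a, v) stands for a e_0 + v. *)
Let carrier : vectType R := (R^o * 'cV[R]_d)%type.

Definition aa_bracket (x y : carrier) : carrier :=
  (0, x.1 *: (M *m y.2) - y.1 *: (M *m x.2)).

Let aa_alt x : aa_bracket x x = 0.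
Proof. by rewrite /aa_bracket subrr. Qed.

Let aa_anti x y : aa_bracket y x = - aa_bracket x y.
Proof. by congr pair; rewrite /= ?oppr0 ?opprB. Qed.

Let aa_linearr x : linear (aa_bracket x).
Proof.
move=> a y z; congr pair; rewrite /= ?scaler0 ?addr0 //.
rewrite mulmxDr -scalemxAr scalerDr scalerDl scalerBr !scalerA.
by rewrite [x.1 * a]mulrC opprD addrACA.
Qed.

Let aa_linearl y : linear (aa_bracket ^~ y).
Proof.
by move=> a x z; rewrite !(aa_anti y) aa_linearr opprD scalerN.
Qed.

Let aa_jacobi x y z :
  aa_bracket x (aa_bracket y z) + aa_bracket y (aa_bracket z x)
    + aa_bracket z (aa_bracket x y) = 0.
Proof.
congr pair; rewrite /= ?addr0 // !scale0r !subr0.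
rewrite !mulmxBr -!scalemxAr !scalerBr !scalerA.
rewrite [y.1 * x.1]mulrC [z.1 * x.1]mulrC [z.1 * y.1]mulrC.
set a := _ *: (M *m (M *m z.2)); set b := _ *: (M *m (M *m y.2)).
set c := _ *: (M *m (M *m x.2)).
by rewrite [a - b + _]addrC subrKA subrKA subrr.
Qed.

Definition almost_abelian : lieAlgebra R :=
  LieAlgebra aa_linearl aa_linearr aa_alt aa_jacobi.

Definition dim_ker : nat :=
  \dim (lker (linfun (mulmx M : 'cV[R]_d -> 'cV[R]_d))).

End AlmostAbelian.

Section Matrices.
Variable R : realType.

(* Square matrices packed with their size, so that block diagonal sums of
   varying sizes need no casts. *)
Definition sqmx := {k : nat & 'M[R]_k}.

Definition pack k (A : 'M[R]_k) : sqmx := Tagged (fun k => 'M[R]_k) A.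

Definition dsum (A B : sqmx) : sqmx :=
  pack (block_mx (tagged A) 0 0 (tagged B)).

Definition zeromx (k : nat) : sqmx := pack (0 : 'M[R]_k).

Definition dsum_copies (p : nat) (A : sqmx) : sqmx :=
  iter p (dsum A) (zeromx 0).

Definition Umx : 'M[R]_(4, 3) := \matrix_(i, j) ((i : nat) == j.+1)%:R.

(* For 4 %| k these are the k/4 x k/4 blocks of size 4 with I_4 on the block
   subdiagonal: the entry (i, j) is 1 exactly when i = j + 4. *)
Definition block_subdiag (k : nat) : 'M[R]_k :=
  \matrix_(i, j) ((i : nat) == j + 4)%N%:R.

Definition Jmx (m : nat) : sqmx := pack (block_subdiag (4 * m)).

Definition border_U (k : nat) (B : 'M[R]_(4 + k)) : sqmx :=
  pack (block_mx (0 : 'M[R]_3) 0 (col_mx Umx (0 : 'M[R]_(k, 3))) B).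

(* Below, for m, s > 0, the size of the lower right block is written
   4 + 4 (m - 1) = 4 m, resp. 4 + 4 (s - 1) = 4 s. *)
Definition Nmx (m p : nat) : sqmx :=
  dsum (border_U (block_subdiag (4 + 4 * (m - 1))))
       (dsum_copies (p - 1) (Jmx m)).

Definition N0mx (s : nat) : sqmx :=
  border_U (0 : 'M[R]_(4 + 4 * (s - 1))).

Section Tuple.
Variables (r : nat) (m p : 'I_r -> nat) (s : nat).

Definition in_Sigma (N : nat) : Prop :=
  [/\ (0 < r)%N,
      forall i j : 'I_r, (i < j)%N -> (m j < m i)%N,
      forall i, (2 <= m i)%N,
      forall i, (0 < p i)%N
    & (\sum_(i < r) m i * p i + s)%N = N].

Definition Jsum (P : pred 'I_r) : sqmx :=
  \big[dsum/zeromx 0]_(i < r | P i) dsum_copies (p i) (Jmx (m i)).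

Definition A_first : sqmx :=
  dsum (zeromx 3) (dsum (Jsum predT) (zeromx (4 * s))).

Definition A_mid (l : 'I_r) : sqmx :=
  dsum (Jsum (fun i : 'I_r => (i < l)%N))
    (dsum (Nmx (m l) (p l))
      (dsum (Jsum (fun i : 'I_r => (l < i)%N)) (zeromx (4 * s)))).

Definition A_last : sqmx := dsum (Jsum predT) (N0mx s).

End Tuple.

Definition tildeSigma (N d : nat) : set 'M[R]_d :=
  [set M | exists r (m p : 'I_r -> nat) (s : nat), in_Sigma m p s N /\
    [\/ pack M = A_first m p s,
        exists l : 'I_r, pack M = A_mid m p s l
      | (0 < s)%N /\ pack M = A_last m p s]].

End Matrices.

(* The isomorphism class of g_M among the almost abelian algebras g_B with
   B in gl(d, R), where g_B is recorded by the matrix B. *)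
Definition iso_class (R : realType) (d : nat) (M : 'M[R]_d) : set 'M[R]_d :=
  [set B | lie_isomorphic (almost_abelian B) (almost_abelian M)].

Definition hypercomplex_nilpotent_classes (R : realType) (n : nat) :
    set (set 'M[R]_(4 * n - 1)) :=
  [set iso_class A | A in
    [set A : 'M[R]_(4 * n - 1) |
      [/\ lie_nilpotent (almost_abelian A),
          admits_hypercomplex (almost_abelian A)
        & (dim_ker A < 4 * (n - 1))%N]]].

(* Main.v *)
From HB Require Import structures.
Require Import Defs.
From mathcomp Require Import all_boot all_order all_algebra.
From mathcomp Require Import boolp classical_sets functions reals.
From mathcomp Require Import zify ring lra mxtens.

(** A hypercomplex structure on g_A amounts to an extension of A to a
    quaternionic-linear endomorphism X of the whole of g_A (with
    [x, y] = x_0 X y - y_0 X x, where x_0 is the coordinate along e_0): if e_0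
    is chosen with all J_a e_0 in the hyperplane R^d, integrability says that
    X e_0 := - J_1 A J_1 e_0 works. Hence rank X^k is divisible by 4 and
    rank A^k is rank X^k or rank X^k - 1; once the two ranks agree, they agree
    for all larger k. So rank A^k = 4 b_k + 3 [k <= l] for some l.

    Nilpotent matrices are classified by the ranks of their powers. Convexity of
    k |-> rank A^k makes b convex, and its second differences give the m_i, p_i
    and s; at k = l it forces the second difference of b to be positive, so that
    l is 0, 1 (with s > 0) or some m_i. These cases are the matrices A_0,
    A_(r+1) and A_i.

    All these matrices are direct sums of shifts e_j |-> e_(j+4): bordering the
    shift of size 4 m by U gives the shift of size 4 m + 3. *)

Set Implicit Arguments.
Unset Strict Implicit.
Unset Printing Implicit Defensive.

Import GRing.Theory Num.Theory.
Local Open Scope classical_set_scope.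
Local Open Scope ring_scope.

(** * Nilpotent matrices are determined by the ranks of their powers *)

Lemma row_free_basis (F : fieldType) (m d k : nat) (V : 'M[F]_(m, d)) :
  \rank V = k -> exists2 X : 'M_(k, d), row_free X & (X :=: V)%MS.
Proof.
by move<-; exists (row_base V); [exact: row_base_free | exact: eq_row_base].
Qed.

Section Extension.
Context (F : fieldType) (d : nat).

Lemma mxrank_mul_inj (V Q : 'M[F]_d) :
  (forall x : 'rV_d, (x <= V)%MS -> x *m Q = 0 -> x = 0) ->
  \rank (V *m Q) = \rank V.
Proof.
move=> injQ; rewrite -[RHS](mxrank_mul_ker V Q).
suff -> : (V :&: kermx Q)%MS = 0 by rewrite mxrank0 addn0.
apply/row_matrixP => i; rewrite row0; apply: injQ.
  exact: submx_trans (row_sub _ _) (capmxSl _ _).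
by apply/sub_kermxP; exact: submx_trans (row_sub _ _) (capmxSr _ _).
Qed.

Lemma mul_inj_of_rank m (V : 'M[F]_(m, d)) (Q : 'M[F]_d) n (x : 'M_(n, d)) :
  \rank (V *m Q) = \rank V -> (x <= V)%MS -> x *m Q = 0 -> x = 0.
Proof.
move=> rk xV xQ; have := mxrank_mul_ker V Q.
rewrite rk -{2}[\rank V]addn0 => /addnI /eqP; rewrite mxrank_eq0 => /eqP k0.
by apply/eqP; rewrite -submx0 -k0 sub_capmx xV; apply/sub_kermxP.
Qed.

(* An intertwiner given on the image V A is extended to V = V A + C + T, where C
   complements V A inside V A + ker A: C is sent isomorphically into ker B, and T
   is sent to any lift through B. *)
Lemma intertwiner_extension (A B V W P : 'M[F]_d) :
  stablemx V A -> stablemx W B -> \rank V = \rank W ->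
  \rank (V *m A) = \rank (W *m B) -> (V *m A *m P :=: W *m B)%MS ->
  V *m A *m A *m P = V *m A *m P *m B ->
  exists2 Q : 'M[F]_d, (V *m Q :=: W)%MS & V *m A *m Q = V *m Q *m B.
Proof.
move=> sV sW rVW rI imP tP.
have injP n (x : 'M_(n, d)) : (x <= V *m A)%MS -> x *m P = 0 -> x = 0.
  by apply: mul_inj_of_rank; rewrite imP rI.
have sVA : stablemx (V *m A) A by exact: submxMr.
have sWB : stablemx (W *m B) B by exact: submxMr.
have tPx n (x : 'M_(n, d)) : (x <= V *m A)%MS -> x *m A *m P = x *m P *m B.
  case/submxP=> y ->; have := congr1 (mulmx y) tP.
  by rewrite !mulmxA.
set KA := (V :&: kermx A)%MS; set KB := (W :&: kermx B)%MS.
have rKA : \rank KA = \rank KB.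
  apply: (@addnI (\rank (V *m A))); rewrite mxrank_mul_ker rVW rI.
  by rewrite mxrank_mul_ker.
(* The part of the kernel inside [V A] has dimension rank [V A] minus rank [V A A], and [P] carries
   these two images onto [W B] and [W B B]. Hence the complements [C] and [D] chosen below have
   equal dimension. *)
have rIA : \rank (KA :&: V *m A)%MS = \rank (KB :&: W *m B)%MS.
  have e (X Y : 'M[F]_d) : stablemx X Y ->
    \rank ((X :&: kermx Y) :&: X *m Y)%MS = \rank (X *m Y :&: kermx Y)%MS.
    move=> sX; apply: eqmx_rank.
    by rewrite capmxC capmxA; apply/andP; split; apply: capmxS => //;
      rewrite ?capmxSl // sub_capmx submx_refl sX.
  rewrite !e //; apply: (@addnI (\rank (V *m A *m A))); rewrite mxrank_mul_ker.
  have -> : \rank (V *m A *m A) = \rank (W *m B *m B).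
    rewrite -(eqmxMr B imP) -tP; symmetry; apply: mxrank_mul_inj => x xs.
    by apply: injP; apply: submx_trans xs sVA.
  by rewrite mxrank_mul_ker rI.
have rC : \rank (KA :\: V *m A)%MS = \rank (KB :\: W *m B)%MS.
  apply: (@addnI (\rank (KA :&: V *m A)%MS)).
  by rewrite mxrank_cap_compl rIA mxrank_cap_compl.
have [E fE eE] := @row_free_basis _ _ _ _ (V *m A) (erefl _).
have [C fC eC] := @row_free_basis _ _ _ _ (KA :\: V *m A)%MS (erefl _).
have [D fD eD] := @row_free_basis _ _ _ _ (KB :\: W *m B)%MS (esym rC).
have [T fT eT] := @row_free_basis _ _ _ _ (V :\: (V *m A + KA))%MS (erefl _).
have sKV : (KA <= V)%MS by exact: capmxSl.
have KAE : (KA <= (V *m A) + C)%MS.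
  rewrite -(addsmx_diff_cap_eq KA (V *m A)) addsmxC.
  by apply: addsmxS; rewrite ?capmxSr ?eC.
(* The rows of [T A P] lie in [W B]; their coefficients with respect to the rows of [W B], applied
   to the rows of [W], give preimages under [B] inside [W]. *)
pose L := T *m A *m P *m pinvmx (W *m B) *m W.
have TV : (T <= V)%MS by rewrite eT diffmxSl.
have CKA : (C <= KA)%MS by rewrite eC diffmxSl.
have DKB : (D <= KB)%MS by rewrite eD diffmxSl.
have TAP : L *m B = T *m A *m P.
  rewrite /L -mulmxA mulmxKpV // -imP.
  by apply: submxMr; apply: submxMr.
pose S := col_mx E (col_mx C T).
pose RR := col_mx (E *m P) (col_mx D L).
have VAKA : (V *m A + KA :=: E + C)%MS.
  apply/eqmxP; rewrite !addsmx_sub -eE addsmxSl /= (adds_eqmx eE (eqmx_refl C)).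
  by rewrite KAE (submx_trans CKA) ?addsmxSr // eE addsmxSl.
have Sum : (V :=: E + C + T)%MS.
  apply/eqmxP; rewrite !addsmx_sub eE sV (submx_trans CKA sKV) TV !andbT.
  rewrite -{1}(addsmx_diff_cap_eq V (V *m A + KA)%MS) addsmxC.
  by apply: addsmxS; rewrite ?eT // -VAKA capmxSr.
have SV : (S :=: V)%MS.
  apply: eqmx_trans (eqmx_sym Sum).
  rewrite -addsmxA; apply: eqmx_trans (eqmx_sym (addsmxE _ _)) _.
  exact: adds_eqmx (eqmx_refl E) (eqmx_sym (addsmxE C T)).
have fS : row_free S.
  rewrite /row_free SV Sum mxrank_disjoint_sum; last first.
    apply/eqP; rewrite -submx0 -(capmx_diff V (V *m A + KA)%MS) sub_capmx.
    by rewrite -eT capmxSr VAKA capmxSl.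
  rewrite mxrank_disjoint_sum; last first.
    apply/eqP; rewrite -submx0 -(capmx_diff KA (V *m A)%MS) sub_capmx.
    by rewrite -eC capmxSr -eE capmxSl.
  by rewrite (eqP fE) (eqP fC) (eqP fT) addnA.
have [Q SQ] : exists Q, S *m Q = RR.
  by exists (pinvmx S *m RR); rewrite mulmxA mulmxVp // mul1mx.
have [EQ CQ TQ] : [/\ E *m Q = E *m P, C *m Q = D & T *m Q = L].
  by move: SQ; rewrite /S /RR !mul_col_mx => /eq_col_mx [-> /eq_col_mx [-> ->]].
have VAQ n (x : 'M_(n, d)) : (x <= V *m A)%MS -> x *m Q = x *m P.
  by rewrite -eE => /submxP[y ->]; rewrite -!mulmxA EQ.
have VAQB n (x : 'M_(n, d)) : (x <= V)%MS -> x *m A *m Q = x *m Q *m B.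
  rewrite -SV => /submxP[y ->]; rewrite -!mulmxA; congr (y *m _); rewrite !mulmxA.
  rewrite SQ /S /RR !mul_col_mx; congr col_mx; last congr col_mx.
  - have EV : (E <= V *m A)%MS by rewrite eE.
    by rewrite VAQ ?tPx // (submx_trans (submxMr A EV)).
  - have -> : C *m A = 0 by apply/sub_kermxP; apply: submx_trans CKA (capmxSr _ _).
    have -> : D *m B = 0 by apply/sub_kermxP; apply: submx_trans DKB (capmxSr _ _).
    by rewrite mul0mx.
  - by rewrite TAP VAQ // submxMr.
exists Q; last by rewrite VAQB.
apply/eqmxP; rewrite -(geq_leqif (mxrank_leqif_eq _)).
  (* If [x Q = 0] then [x A P = x Q B = 0], so [x A = 0] and [x] is a sum of a part in [V A] and a
     part in [C]. [Q] sends these parts into [W B] and into the span of [D], which meet trivially,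
     so both vanish. *)
  rewrite -rVW mxrank_mul_inj // => x xV xQ.
  have xA0 : x *m A = 0.
    by apply: injP; rewrite ?submxMr // -VAQ ?submxMr // VAQB // xQ mul0mx.
  have : (x <= KA)%MS by rewrite sub_capmx xV; apply/sub_kermxP.
  move/submx_trans => /(_ _ _ KAE)/sub_addsmxP[[u v] /= xE].
  have uA : (u *m (V *m A) <= V *m A)%MS by exact: submxMl.
  have h : u *m (V *m A) *m P = - (v *m D).
    by apply/eqP; rewrite -addr_eq0 -CQ -(VAQ _ _ uA) [v *m _]mulmxA -mulmxDl -xE xQ.
  have D0 : v *m D = 0.
    apply/eqP; rewrite -submx0 -(capmx_diff KB (W *m B)) sub_capmx -eD submxMl.
    by rewrite -(opprK (v *m D)) -h eqmx_opp -imP submxMr.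
  move/eqP: D0; rewrite mulmx_free_eq0 // => /eqP v0.
  rewrite xE v0 mul0mx addr0; apply: injP => //.
  by rewrite h v0 mul0mx oppr0.
rewrite -(eqmxMr Q SV) SQ /RR !col_mx_sub.
rewrite submxMl (submx_trans DKB (capmxSl _ _)) !andbT.
by rewrite (submx_trans _ sW) // -imP submxMr // eE.
Qed.
End Extension.

(** Downward induction on the exponent: an intertwining isomorphism between the images of
    [A ^+ k.+1] and [B ^+ k.+1] extends to the images of the [k]-th powers. It starts with the zero
    map at exponent [K] and ends at exponent 0 with the whole space. *)
Lemma nilpotent_similar (F : fieldType) (d : nat) (A B : 'M[F]_d) (K : nat) :
  A ^+ K = 0 -> B ^+ K = 0 -> (forall k, \rank (A ^+ k) = \rank (B ^+ k)) ->
  exists2 Q : 'M[F]_d, Q \in unitmx & A *m Q = Q *m B.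
Proof.
move=> A0 B0 rk.
have main j : (j <= K)%N -> exists2 Q : 'M[F]_d,
    (A ^+ (K - j) *m Q :=: B ^+ (K - j))%MS &
    A ^+ (K - j) *m A *m Q = A ^+ (K - j) *m Q *m B; last first.
  have [Q] := main K (leqnn K); rewrite subnn !expr0 !mul1mx => eQ tQ; exists Q => //.
  by rewrite -row_full_unit -sub1mx eQ.
elim: j => [_|j IH jK].
  by rewrite subn0 A0 B0; exists 0; rewrite ?mul0mx.
have [P eP tP] := IH (ltnW jK).
have e : (K - j = (K - j.+1).+1)%N by lia.
have exS (X : 'M[F]_d) : X ^+ (K - j.+1) *m X = X ^+ (K - j) by rewrite e exprSr.
apply: (@intertwiner_extension _ _ _ _ _ _ P); rewrite ?exS //.
- by rewrite e exprS submxMl.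
- by rewrite e exprS submxMl.
Qed.

(** * Lie algebras and lower central series *)

(** [A] is [col_base A] times [row_base A]: the second factor is onto, the first is injective with
    [\rank A] columns. *)
Lemma dim_limg_mulmx (F : fieldType) (m n : nat) (A : 'M[F]_(m, n)) :
  \dim (limg (linfun (mulmx A : 'cV[F]_n -> 'cV[F]_m))) = \rank A.
Proof.
pose g := linfun (mulmx (col_base A) : 'cV[F]_(\rank A) -> 'cV[F]_m).
have gker : lker g == 0%VS.
  by apply/lker0P => x y; rewrite !lfunE /=; apply/row_full_inj/col_base_full.
have -> : limg (linfun (mulmx A : 'cV[F]_n -> 'cV[F]_m)) = limg g.
  apply/vspaceP => y; apply/memv_imgP/memv_imgP => -[x _ ->]; rewrite lfunE /=.
    by exists (row_base A *m x); rewrite ?memvf // lfunE /= mulmxA mulmx_base.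
  exists (pinvmx (row_base A) *m x); rewrite ?memvf // lfunE /=.
  have := congr1 (mulmx^~ (pinvmx (row_base A))) (mulmx_base A).
  rewrite -mulmxA mulmxVp ?row_base_free // mulmx1 => h.
  exact: etrans (congr1 (mulmx^~ x) h) (esym (mulmxA _ _ _)).
rewrite limg_dim_eq; first by rewrite dimvf /dim /= muln1.
by rewrite (eqP gker) capv0.
Qed.

Section Lie.
Context (R : realType).
Implicit Types L : lieAlgebra R.

HB.instance Definition _ L (x : L) :=
  GRing.isLinear.Build R L L *:%R (bracket x) (bracket_linearr x).

Definition bracketr L (y x : L) : L := bracket x y.
HB.instance Definition _ L (y : L) :=
  GRing.isLinear.Build R L L *:%R (bracketr y) (bracket_linearl y).

(** Since [bracketv] is spanned by brackets of basis vectors, this serves to pass to arbitrary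
    vectors, one argument at a time. *)
Lemma linear_vbasis_sub (aT rT : vectType R) (f : {linear aT -> rT})
    (U : {vspace aT}) (W : {vspace rT}) :
  {in vbasis U, forall x, f x \in W} -> {in U, forall x, f x \in W}.
Proof.
move=> h x xU; rewrite (coord_vbasis xU) linear_sum memv_suml // => i _.
by rewrite linearZ memvZ // h // mem_nth // size_tuple.
Qed.

Lemma bracketv_subP L (U V W : {vspace L}) :
  {in U & V, forall x y, bracket x y \in W} -> (bracketv U V <= W)%VS.
Proof.
move=> h; apply/span_subvP => z /allpairsP[[x y] /= [xU yV ->]].
by apply: h; apply: vbasis_mem.
Qed.

Lemma mem_bracketv L (U V : {vspace L}) x y :
  x \in U -> y \in V -> bracket x y \in bracketv U V.
Proof.
move=> xU; apply: linear_vbasis_sub => {}y yV.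
suff: bracketr y x \in bracketv U V by [].
apply: linear_vbasis_sub xU => {}x xU; apply: memv_span.
by apply/allpairsP; exists (x, y).
Qed.

Lemma lower_central_img L1 L2 (f : 'Hom(L1, L2)) k :
  (forall x y, f (bracket x y) = bracket (f x) (f y)) ->
  (f @: lower_central L1 k <= lower_central L2 k)%VS.
Proof.
move=> fM; elim: k => [|k IH]; first exact: subvf.
apply/subvP => _ /memv_imgP[z zk ->]; rewrite memv_preim.
move: z zk; apply/subvP; apply: bracketv_subP => x y _ yk.
by rewrite -memv_preim fM mem_bracketv ?memvf // (subvP IH) ?memv_img.
Qed.

Lemma lie_isomorphic_refl L : lie_isomorphic L L.
Proof.
exists \1%VF; split=> [|x y]; last by rewrite !lfunE.
by exists id => x; rewrite !lfunE.
Qed.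

Lemma lie_isomorphic_sym L1 L2 : lie_isomorphic L1 L2 -> lie_isomorphic L2 L1.
Proof.
case=> f [fbij fM]; have finj := bij_inj fbij.
have kf : lker f == 0%VS by apply/lker0P.
have fK : cancel f f^-1%VF := lker0_lfunK kf.
have fV : cancel f^-1%VF f by apply/(bij_can_sym fbij).
exists f^-1%VF; split=> [|x y]; first by exists f.
by apply: finj; rewrite fM !fV.
Qed.

Lemma lie_isomorphic_trans L1 L2 L3 :
  lie_isomorphic L1 L2 -> lie_isomorphic L2 L3 -> lie_isomorphic L1 L3.
Proof.
case=> f [fbij fM] [g [gbij gM]]; exists (g \o f)%VF; split=> [|x y].
  by apply: (eq_bij (bij_comp gbij fbij)) => x; rewrite lfunE.
by rewrite !lfunE /= fM gM.
Qed.

Lemma lie_isomorphic_dim_lower_central L1 L2 k :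
  lie_isomorphic L1 L2 ->
  \dim (lower_central L1 k) = \dim (lower_central L2 k).
Proof.
have le (M1 M2 : lieAlgebra R) : lie_isomorphic M1 M2 ->
  (\dim (lower_central M1 k) <= \dim (lower_central M2 k))%N.
  case=> f [fbij fM]; rewrite -(@limg_dim_eq _ _ _ f).
    by apply: dimvS; apply: lower_central_img.
  have /eqP -> : lker f == 0%VS by apply/lker0P/bij_inj.
    by rewrite capv0.
move=> iso; apply/eqP; rewrite eqn_leq !le //.
exact: lie_isomorphic_sym.
Qed.

End Lie.

(** * Lower central series of almost abelian algebras *)

Section AlmostAbelianTheory.
Context (R : realType) (d : nat) (M : 'M[R]_d).

Definition aa_vec (x : 'cV[R]_d) : almost_abelian M := (0, x).

Lemma aa_vec_linear : linear aa_vec.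
Proof. by move=> a x y; congr pair; rewrite /= ?scaler0 ?addr0. Qed.

HB.instance Definition _ :=
  GRing.isLinear.Build R _ _ *:%R aa_vec aa_vec_linear.

Lemma bracketE (x y : almost_abelian M) :
  bracket x y = aa_vec (x.1 *: (M *m y.2) - y.1 *: (M *m x.2)).
Proof. by []. Qed.

Lemma lower_centralS (L : lieAlgebra R) k :
  lower_central L k.+1 = bracketv fullv (lower_central L k).
Proof. by []. Qed.

(** Bracketing with a vector of the ideal multiplies it by [M], up to the factor x_0. The formula
    starts at index 1 because the term of index 0 also contains e_0. *)
Lemma lower_central_aa k : lower_central (almost_abelian M) k.+1 =
  (linfun aa_vec @: limg (linfun (mulmx (M ^+ k.+1) : 'cV_d -> 'cV_d)))%VS.
Proof.
have memI j x : (x \in linfun aa_vec @: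
    limg (linfun (mulmx (M ^+ j) : 'cV_d -> 'cV_d)))%VS <->
    exists y, x = aa_vec (M ^+ j *m y).
  split=> [/memv_imgP[_ /memv_imgP[y _ ->] ->]|[y ->]].
    by exists y; rewrite !lfunE.
  have -> : aa_vec (M ^+ j *m y) =
    linfun aa_vec (linfun (mulmx (M ^+ j) : 'cV_d -> 'cV_d) y) by rewrite !lfunE.
  by rewrite !memv_img ?memvf.
elim: k => [|k IH]; rewrite lower_centralS ?IH; apply/eqP; rewrite eqEsubv;
  apply/andP; split.
- apply: bracketv_subP => x y _ _; rewrite bracketE !scalemxAr -mulmxBr.
  by apply/memI; rewrite expr1; eexists.
- apply/subvP => _ /memI[y ->].
  have -> : aa_vec (M ^+ 1 *m y) = bracket ((1, 0) : almost_abelian M) (aa_vec y).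
    by rewrite bracketE expr1 /= scale1r scale0r subr0.
  by rewrite mem_bracketv ?memvf.
- apply: bracketv_subP => x _ _ /memI[y ->].
  rewrite bracketE /= scale0r subr0 !scalemxAr mulmxA -[M *m _]exprS.
  by apply/memI; eexists.
- apply/subvP => _ /memI[y ->].
  have -> : aa_vec (M ^+ k.+2 *m y) =
      bracket ((1, 0) : almost_abelian M) (aa_vec (M ^+ k.+1 *m y)).
    by rewrite bracketE /= scale1r scale0r subr0 exprS mulmxA.
  by rewrite mem_bracketv ?memvf //; apply/memI; exists y.
Qed.

Lemma dim_lower_central_aa k :
  \dim (lower_central (almost_abelian M) k.+1) = \rank (M ^+ k.+1).
Proof.
rewrite lower_central_aa limg_dim_eq; first exact: dim_limg_mulmx.
have /eqP -> : lker (linfun aa_vec) == 0%VS.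
  by apply/lker0P => x y; rewrite !lfunE => -[].
by rewrite capv0.
Qed.

Lemma dim_aa : \dim (lower_central (almost_abelian M) 0) = d.+1.
Proof. by rewrite dimvf; apply: (congr1 (addn 1) (muln1 d)). Qed.

Lemma lie_nilpotent_aa :
  lie_nilpotent (almost_abelian M) <-> exists k, M ^+ k = 0.
Proof.
split=> [[[|k]]|[k Mk]].
- by move/(congr1 (@dimv _ _)); rewrite dim_aa dimv0.
- move/(congr1 (@dimv _ _)); rewrite dim_lower_central_aa dimv0 => /eqP.
  by rewrite mxrank_eq0 => /eqP Mk; exists k.+1.
exists k.+1; apply/eqP; rewrite -dimv_eq0 dim_lower_central_aa exprS Mk mulr0.
by rewrite mxrank0.
Qed.

Lemma dim_kerE : dim_ker M = (d - \rank M)%N.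
Proof.
have := limg_ker_dim (linfun (mulmx M : 'cV_d -> 'cV_d)) fullv.
by rewrite capfv dim_limg_mulmx dimvf /dim /= muln1 => /(canRL (addnK _)).
Qed.

End AlmostAbelianTheory.

(** For positive [k] these ranks are the dimensions of the lower central series; for [k = 0] both
    equal [d]. *)
Lemma lie_isomorphic_aa_rank (R : realType) (d : nat) (A B : 'M[R]_d) k :
  lie_isomorphic (almost_abelian A) (almost_abelian B) ->
  \rank (A ^+ k) = \rank (B ^+ k).
Proof.
case: k => [|k] iso; first by rewrite !expr0.
by rewrite -!dim_lower_central_aa; exact: lie_isomorphic_dim_lower_central.
Qed.

(** Fix e_0 and apply [Q] to the ideal. *)
Lemma lie_isomorphic_aa_similar (R : realType) (d : nat) (A B Q : 'M[R]_d) :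
  Q \in unitmx -> A *m Q = Q *m B ->
  lie_isomorphic (almost_abelian B) (almost_abelian A).
Proof.
move=> uQ AQ.
pose f (x : almost_abelian B) : almost_abelian A := (x.1, Q *m x.2).
have fL : linear f.
  by move=> a x y; congr pair; rewrite /= mulmxDr -scalemxAr.
pose fl := GRing.isLinear.Build R _ _ *:%R f fL.
pose F : {linear _ -> _} := HB.pack f fl.
exists (linfun F); split=> [|x y].
  exists (fun x : almost_abelian A => (x.1, invmx Q *m x.2)) => -[a x];
    by rewrite lfunE /= /f /= ?mulKmx ?mulKVmx.
rewrite !lfunE /= /f; congr pair => /=.
by rewrite !mulmxBr -!scalemxAr !mulmxA AQ.
Qed.

(** * Hypercomplex structures as quaternionic extensions *)

Section Hypercomplex.
Context (R : realType).

Definition quaternionic k (X : 'M[R]_k) : Prop := exists i j : 'M[R]_k,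
  [/\ i *m i = - 1%:M, j *m j = - 1%:M, i *m j = - (j *m i),
      i *m X = X *m i & j *m X = X *m j].

(** In the coordinates of R e_0 + R^d these are the endomorphisms that restrict to [A] on R^d; e_0
    goes to [a] e_0 + [b]. *)
Definition extend_mx d (a : R) (b : 'cV[R]_d) (A : 'M[R]_d) : 'M[R]_(1 + d) :=
  block_mx a%:M 0 b A.

Section Coordinates.
Context (d : nat) (A : 'M[R]_d).
Local Notation L := (almost_abelian A).

Definition aa_col (x : L) : 'cV[R]_(1 + d) := col_mx x.1%:M x.2.
Definition col_aa (z : 'cV[R]_(1 + d)) : L := (usubmx z 0 0, dsubmx z).

Lemma aa_colK : cancel aa_col col_aa.
Proof. by case=> t x; rewrite /col_aa /aa_col col_mxKu col_mxKd mxE eqxx. Qed.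

Lemma col_aaK : cancel col_aa aa_col.
Proof. by move=> z; rewrite /aa_col /= -mx11_scalar vsubmxK. Qed.

Lemma aa_col_linear : linear aa_col.
Proof.
move=> a x y; rewrite /aa_col scale_col_mx add_col_mx; congr col_mx.
by rewrite scale_scalar_mx -raddfD.
Qed.
HB.instance Definition _ :=
  GRing.isLinear.Build R _ _ *:%R aa_col aa_col_linear.

Lemma col_aa_linear : linear col_aa.
Proof.
by move=> a x y; apply: (can_inj aa_colK); rewrite aa_col_linear !col_aaK.
Qed.
HB.instance Definition _ :=
  GRing.isLinear.Build R _ _ *:%R col_aa col_aa_linear.

Lemma col_mulmx_inj k l (X Y : 'M[R]_(k, l)) :
  (forall z : 'cV_l, X *m z = Y *m z) -> X = Y.
Proof.
move=> h; apply: trmx_inj; apply/row_matrixP => i.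
by rewrite -!tr_col !colE h.
Qed.

Lemma exists_matrix (f : {linear L -> L}) :
  exists X : 'M[R]_(1 + d), forall x, X *m aa_col x = aa_col (f x).
Proof.
pose g (u : 'rV[R]_(1 + d)) := (aa_col (f (col_aa u^T)))^T.
have gL : linear g by move=> a x y; rewrite /g !linearP.
pose gl := GRing.isLinear.Build R _ _ *:%R g gL.
pose G : {linear _ -> _} := HB.pack g gl.
exists (lin1_mx G)^T => x; apply: trmx_inj.
by rewrite trmx_mul trmxK mul_rV_lin1 /= /g trmxK aa_colK.
Qed.

End Coordinates.

Section Extension.
Context (d : nat) (A : 'M[R]_d).
Local Notation L := (almost_abelian A).

(* [x.1] itself lives in [R^o], whose structures hide the ring lemmas of [R]. *)
Definition aa_fst (x : L) : R := x.1.

Lemma aa_fstD x y : aa_fst (x + y) = aa_fst x + aa_fst y. Proof. by []. Qed.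
Lemma aa_fstZ k x : aa_fst (k *: x) = k * aa_fst x. Proof. by []. Qed.
Lemma aa_fstN x : aa_fst (- x) = - aa_fst x. Proof. by []. Qed.
Definition aa_fstE := (aa_fstD, aa_fstZ, aa_fstN).

(** Let h = 1 + a i + b j + c k. The e_0-coordinate of q w, for a quaternion q, is the inner product
    of q and h; so for z = h w the coordinate of q z is |h|^2 Re q. Dividing by |h|^2 > 0 gives
    [e]. *)
Lemma exists_adapted (J1 J2 : {linear L -> L}) :
  (forall x, J1 (J1 x) = - x) -> (forall x, J2 (J2 x) = - x) ->
  (forall x, J1 (J2 x) = - J2 (J1 x)) ->
  exists e : L, [/\ aa_fst e = 1, aa_fst (J1 e) = 0, aa_fst (J2 e) = 0
                  & aa_fst (J1 (J2 e)) = 0].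
Proof.
move=> J11 J22 J12; pose w : L := (1, 0).
pose a := aa_fst (J1 w); pose b := aa_fst (J2 w); pose c := aa_fst (J1 (J2 w)).
pose z := w + a *: J1 w + b *: J2 w + c *: J1 (J2 w).
have w1 : aa_fst w = 1 by [].
have J21 x : J2 (J1 x) = - J1 (J2 x) by rewrite J12 opprK.
have z1 : aa_fst z = 1 + a ^+ 2 + b ^+ 2 + c ^+ 2.
  by rewrite /z !aa_fstE w1 -/a -/b -/c !expr2.
have N0 : aa_fst z != 0 by rewrite z1; apply: lt0r_neq0; nra.
have e1 : aa_fst (J1 z) = 0.
  rewrite /z !linearD !linearZ_LR !J11 !aa_fstE w1 -/a -/b -/c; ring.
have J2z : J2 z = J2 w - a *: J1 (J2 w) - b *: w + c *: J1 w.
  by rewrite /z !linearD !linearZ_LR !J21 !J22 (raddfN J1) opprK !scalerN.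
have e2 : aa_fst (J2 z) = 0.
  rewrite J2z !aa_fstE w1 -/a -/b -/c; ring.
have e3 : aa_fst (J1 (J2 z)) = 0.
  rewrite J2z linearD !linearB !linearZ_LR !J11 !aa_fstE w1 -/a -/b -/c; ring.
exists ((aa_fst z)^-1 *: z).
by rewrite !linearZ_LR !aa_fstZ mulVf // e1 e2 e3 !mulr0.
Qed.

Lemma hypercomplex_extension : admits_hypercomplex L ->
  exists a b, quaternionic (extend_mx a b A).
Proof.
case=> J1 [J2 [J3 [[E1 E2 _] <- E3 [I1 I2 _]]]].
have J11 x : J1 (J1 x) = - x.
  by have := congr1 (fun f : 'End(L) => f x) E1; rewrite !lfunE /= !lfunE.
have J22 x : J2 (J2 x) = - x.
  by have := congr1 (fun f : 'End(L) => f x) E2; rewrite !lfunE /= !lfunE.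
have J12 x : J1 (J2 x) = - J2 (J1 x).
  have := congr1 (fun f : 'End(L) => f x) E3.
  by rewrite !lfunE /= !lfunE.
have [e [e0 e1 e2 e3]] := exists_adapted J11 J22 J12.
rewrite /= in e1 e2 e3.
pose D := bracket e.
have brJ (u z : L) : aa_fst u = 0 -> bracket u z = - (aa_fst z *: D u).
  move=> u0; rewrite /D !bracketE -!/(aa_fst _) u0 e0 !scale0r sub0r subr0 scale1r.
  by rewrite linearN linearZ_LR.
have JD (J : 'End(L)) x y : J (x + y) = J x + J y by exact: linearD.
have JZ (J : 'End(L)) k x : J (k *: x) = k *: J x by exact: linearZZ.
have JN (J : 'End(L)) x : J (- x) = - J x by exact: linearN.
have J0 (J : 'End(L)) : J 0 = 0 by exact: linear0.
(* This is integrability at [e] and [z], after applying [J]; it says that [D] corrected by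
   [- J (D (J e))] along the e_0-coordinate commutes with [J]. *)
have key (J : 'End(L)) : (forall x, J (J x) = - x) -> integrable J ->
    aa_fst (J e) = 0 ->
  forall z, D (J z) - aa_fst (J z) *: J (D (J e))
            = J (D z) + aa_fst z *: D (J e).
  move=> JJ IJ Je z; have := congr1 J (IJ e z); rewrite !(brJ _ _ Je) -!/(D _).
  rewrite opprK !JD JN !JZ J0 JJ JN !JZ JJ scalerN opprK -addrA.
  move/eqP; rewrite addr_eq0 => /eqP ->.
  by rewrite opprD opprB addrAC subrK.
(* The correction has to be the same for [J1] and [J2]. On the vectors [J2 e] and [J1 (J2 e)] all
   coordinates in [key] vanish, so [D] commutes there with [J1], respectively [J2], and
   [J2 J1 J2 = J1] closes the loop. *)
have eqw : J1 (D (J1 e)) = J2 (D (J2 e)).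
  have := key J1 J11 I1 e1 (J2 e); rewrite e2 e3 !scale0r subr0 addr0 => De3.
  have J232 : J2 (J1 (J2 e)) = J1 e.
    by apply: oppr_inj; rewrite -J12 J22 JN.
  have := key J2 J22 I2 e2 (J1 (J2 e)).
  rewrite J232 e1 e3 !scale0r subr0 addr0 => ->.
  by rewrite De3 J12 J11 JN opprK.
pose w := - J1 (D (J1 e)).
pose f z := D z + aa_fst z *: w.
have fL : linear f.
  move=> k x y; rewrite /f /D linearP aa_fstD aa_fstZ scalerDl scalerDr scalerA.
  by rewrite addrACA.
pose fl := GRing.isLinear.Build R _ _ *:%R f fL.
pose F : {linear _ -> _} := HB.pack f fl.
have [X hX] := exists_matrix F.
have [i hi] : exists i : 'M_(1 + d), forall x : L, i *m aa_col x = aa_col (J1 x)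
  by exact: exists_matrix.
have [j hj] : exists j : 'M_(1 + d), forall x : L, j *m aa_col x = aa_col (J2 x)
  by exact: exists_matrix.
have f1 z : F (J1 z) = J1 (F z).
  rewrite /= /f /w JD JZ JN J11 opprK -key //.
  by rewrite scalerN.
have f2 z : F (J2 z) = J2 (F z).
  rewrite /= /f /w eqw JD JZ JN J22 opprK -key //.
  by rewrite scalerN.
(* On the hyperplane [f] is [D], which acts there as [A] because [e] has e_0-coordinate 1. *)
have [X0 XA] : ursubmx X = 0 /\ drsubmx X = A.
  have XE (z : 'cV_d) : col_mx (ursubmx X *m z) (drsubmx X *m z) = col_mx 0 (A *m z).
    have := hX (aa_vec A z); rewrite /= /f /D bracketE.
    rewrite -[(aa_vec A z).1]/(aa_fst (aa_vec A z)) -[e.1]/(aa_fst e).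
    rewrite e0 [aa_fst _]/(0 : R) !scale0r addr0 subr0 scale1r /aa_col /= raddf0.
    by rewrite -{1}(submxK X) mul_block_col !mulmx0 !add0r.
  by split; apply: col_mulmx_inj => z; have /eq_col_mx[] := XE z;
    rewrite ?mul0mx.
exists (ulsubmx X 0 0), (dlsubmx X).
have -> : extend_mx (ulsubmx X 0 0) (dlsubmx X) A = X.
  by rewrite /extend_mx -mx11_scalar -{1}XA -X0 submxK.
have eqM (Y Z : 'M[R]_(1 + d)) :
    (forall x : L, Y *m aa_col x = Z *m aa_col x) -> Y = Z.
  by move=> h; apply: col_mulmx_inj => z; rewrite -(col_aaK A z).
exists i, j; split; apply: eqM => x.
- by rewrite -mulmxA !hi J11 linearN mulNmx mul1mx.
- by rewrite -mulmxA !hj J22 linearN mulNmx mul1mx.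
- by rewrite mulNmx -!mulmxA hj !hi hj J12 linearN.
- by rewrite -!mulmxA hX !hi hX f1.
- by rewrite -!mulmxA hX !hj hX f2.
Qed.

(** Once [J] is moved past [F], the outer [J] turns the two mixed brackets into the terms of
    [[J x, J y] - [x, y]]. *)
Lemma integrable_commuting (J F : 'End(L)) :
  (forall x y : L, bracket x y = aa_fst x *: F y - aa_fst y *: F x) ->
  (forall x, J (J x) = - x) -> (forall x, J (F x) = F (J x)) -> integrable J.
Proof.
move=> br JJ JF x y; rewrite !br -!JF.
have JD u v : J (u + v) = J u + J v by exact: linearD.
have JZ k u : J (k *: u) = k *: J u by exact: linearZZ.
have JN u : J (- u) = - J u by exact: linearN.
rewrite !(JD, JN, JZ) !JJ !scalerN !opprK.
set p := aa_fst x *: F y; set q := aa_fst y *: F x.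
set r := aa_fst (J x) *: _; set s := aa_fst (J y) *: _.
have -> : r + q + (- p - s) = (q - p) + (r - s) by rewrite [r + q]addrC addrACA.
by rewrite -[p - q]opprB addKr subrr.
Qed.

Lemma extension_hypercomplex a b :
  quaternionic (extend_mx a b A) -> admits_hypercomplex L.
Proof.
case=> i [j [ii jj ij iX jX]].
pose op (X : 'M[R]_(1 + d)) (x : L) : L := col_aa A (X *m aa_col x).
have opL X : linear (op X).
  by move=> k x y; rewrite /op linearP mulmxDr -scalemxAr linearP.
pose op' X : {linear L -> L} :=
  HB.pack (op X) (GRing.isLinear.Build R _ _ *:%R (op X) (opL X)).
pose f X : 'End(L) := linfun (op' X).
have fE X x : f X x = col_aa A (X *m aa_col x) by rewrite lfunE.
have fM X Y x : f X (f Y x) = f (X *m Y) x.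
  by rewrite !fE col_aaK mulmxA.
have fN X : f (- X) = - f X.
  by apply/lfunP => x; rewrite opp_lfunE !fE mulNmx linearN.
have f1 : f 1%:M = \1%VF.
  by apply/lfunP => x; rewrite id_lfunE fE mul1mx aa_colK.
(* The column ([a], [b]) contributes x_0 y_0 times itself to both terms and cancels, so any
   extension of [A] computes the bracket. *)
have br (x y : L) : bracket x y =
    aa_fst x *: f (extend_mx a b A) y - aa_fst y *: f (extend_mx a b A) x.
  have E (z : L) : extend_mx a b A *m aa_col z =
      col_mx (aa_fst z *: a%:M) (aa_fst z *: b + A *m z.2).
    rewrite /extend_mx /aa_col mul_block_col mul0mx addr0 -/(aa_fst z).
    by rewrite !mul_mx_scalar.
  apply: (can_inj (@aa_colK _ A)); rewrite !fE.
  have lin k l (u v : L) : aa_col (k *: u - l *: v) = k *: aa_col u - l *: aa_col v.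
    by rewrite linearB !linearZZ.
  rewrite lin !col_aaK !E.
  rewrite !scale_col_mx opp_col_mx add_col_mx !scalerDr !scalerA.
  rewrite [aa_fst y * _]mulrC subrr opprD addrACA subrr add0r.
  by rewrite /aa_col bracketE /= raddf0.
have fc X Y : (f X \o f Y)%VF = f (X *m Y).
  by apply/lfunP => x; rewrite comp_lfunE fM.
have sq X : X *m X = - 1%:M -> forall x, f X (f X x) = - x.
  by move=> XX x; rewrite fM XX fN f1 opp_lfunE id_lfunE.
have kk : (i *m j) *m (i *m j) = - 1%:M.
  by rewrite {1}ij mulNmx mulmxA -(mulmxA j i i) ii mulmxN mulmx1 mulNmx opprK jj.
have kX : (i *m j) *m extend_mx a b A = extend_mx a b A *m (i *m j).
  by rewrite -mulmxA jX mulmxA iX -mulmxA.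
exists (f i), (f j), (f (i *m j)).
split; first by rewrite !fc ii jj kk fN f1.
- by rewrite fc.
- by rewrite fc -fN -ij.
have int X : X *m X = - 1%:M ->
    X *m extend_mx a b A = extend_mx a b A *m X -> integrable (f X).
  by move=> XX XE; apply: integrable_commuting br (sq X XX) _ => x; rewrite !fM XE.
by split; apply: int.
Qed.

End Extension.
End Hypercomplex.

(** * Ranks modulo 4 *)

Section QuaternionicMatrices.
Context (R : realType).

(** If the combination y = q x lies in [W], then so does the product of y with the conjugate of q,
    which is |q|^2 x. As [x] is outside [W], this forces |q|^2 = 0. *)
Lemma quaternion_line_free n (i j W : 'M[R]_n) (x : 'rV[R]_n) (u : 'rV[R]_4) :
  i *m i = - 1%:M -> j *m j = - 1%:M -> i *m j = - (j *m i) ->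
  stablemx W i -> stablemx W j -> ~~ (x <= W)%MS ->
  (u *m (col_mx x (col_mx (x *m i) (col_mx (x *m j) (x *m i *m j)))) <= W)%MS ->
  u = 0.
Proof.
move=> ii jj ij Wi Wj xW.
pose a := u 0 0; pose b := u 0 1; pose c := u 0 2%:R; pose e := u 0 3%:R.
set e1 := x *m i; set e2 := x *m j; set e3 := x *m i *m j.
have uE : u *m col_mx x (col_mx e1 (col_mx e2 e3)) =
  a *: x + b *: e1 + c *: e2 + e *: e3.
  have split_row m (v : 'rV[R]_(1 + m)) (z : 'rV[R]_n) (Z : 'M[R]_(m, n)) :
      v *m col_mx z Z = v 0 0 *: z + rsubmx v *m Z.
    rewrite -{1}[v]hsubmxK mul_row_col [lsubmx v]mx11_scalar mul_scalar_mx mxE.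
    by congr (v _ _ *: _ + _); apply: val_inj.
  rewrite !(@split_row 3) !(@split_row 2) !(@split_row 1).
  have one (v : 'rV[R]_1) (Z : 'M[R]_(1, n)) : v *m Z = v 0 0 *: Z.
    by rewrite {1}[v]mx11_scalar mul_scalar_mx.
  rewrite one !mxE !addrA.
  by rewrite /a /b /c /e; do ![congr (_ + _)]; congr (u _ _ *: _); apply: val_inj.
rewrite uE; set y := (X in (X <= W)%MS -> _) => yW.
have e1i : e1 *m i = - x by rewrite -mulmxA ii mulmxN mulmx1.
have e1j : e1 *m j = e3 by [].
have e2i : e2 *m i = - e3 by rewrite /e2 /e3 -!mulmxA ij mulmxN opprK.
have e2j : e2 *m j = - x by rewrite -mulmxA jj mulmxN mulmx1.
have e3j : e3 *m j = - e1 by rewrite /e3 -mulmxA jj mulmxN mulmx1.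
have e3i : e3 *m i = e2.
  by rewrite /e3 -mulmxA -[j *m i]opprK -ij mulmxN mulmxA e1i mulNmx opprK.
have yi : y *m i = a *: e1 - b *: x - c *: e3 + e *: e2.
  by rewrite /y !mulmxDl -!scalemxAl e1i e2i e3i !scalerN.
have yj : y *m j = a *: e2 + b *: e3 - c *: x - e *: e1.
  by rewrite /y !mulmxDl -!scalemxAl e1j e2j e3j !scalerN.
have yk : y *m i *m j = a *: e3 - b *: e2 + c *: e1 - e *: x.
  by rewrite yi !mulmxDl !mulNmx -!scalemxAl e1j e2j e3j !scalerN opprK.
have sum : (a ^+ 2 + b ^+ 2 + c ^+ 2 + e ^+ 2) *: x =
    a *: y - b *: (y *m i) - c *: (y *m j) - e *: (y *m i *m j).
  rewrite yk yi yj /y; apply/rowP => l; rewrite !mxE; ring.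
have N0 : a ^+ 2 + b ^+ 2 + c ^+ 2 + e ^+ 2 = 0.
  apply/eqP; apply: contraNT xW => N0.
  rewrite -(eqmx_scale _ N0) sum; have yiW : (y *m i <= W)%MS.
    exact: submx_trans (submxMr i yW) Wi.
  have yjW : (y *m j <= W)%MS by exact: submx_trans (submxMr j yW) Wj.
  have ykW : (y *m i *m j <= W)%MS by exact: submx_trans (submxMr j yiW) Wj.
  by rewrite !addmx_sub ?eqmx_opp ?scalemx_sub.
have [a0 b0 c0 f0] : [/\ a = 0, b = 0, c = 0 & e = 0] by split; nra.
apply/rowP => l; rewrite mxE.
case: l => [[|[|[|[|//]]]] lt4]; [rewrite -[RHS]a0|rewrite -[RHS]b0
  |rewrite -[RHS]c0|rewrite -[RHS]f0]; congr (u _ _); exact: val_inj.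
Qed.

(** Stable subspaces of [V] are built by adding one quaternionic line, of real dimension 4, at a
    time. *)
Lemma quaternionic_rank n (i j V : 'M[R]_n) :
  i *m i = - 1%:M -> j *m j = - 1%:M -> i *m j = - (j *m i) ->
  stablemx V i -> stablemx V j -> (4 %| \rank V)%N.
Proof.
move=> ii jj ij Vi Vj.
(* The slack 3 allows [t] to be the rank divided by 4 and rounded up: each new line only needs
   [4 * t < \rank V] beforehand, and the last subspace has dimension at least [\rank V] while lying
   in [V]. *)
have main t : (4 * t <= \rank V + 3)%N -> exists2 W : 'M[R]_n,
    [/\ stablemx W i, stablemx W j & (W <= V)%MS] & \rank W = (4 * t)%N.
  elim: t => [|t IH] le; first by exists 0; rewrite ?mxrank0 // !mul0mx !sub0mx.
  have [|W [Wi Wj WV] rW] := IH; first by lia.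
  have : ~~ (V <= W)%MS by apply: contraL le => /mxrankS; lia.
  case/row_subPn => r xW; set x := row r V in xW.
  have xV : (x <= V)%MS by exact: row_sub.
  have xiV : (x *m i <= V)%MS by exact: submx_trans (submxMr i xV) Vi.
  have xjV : (x *m j <= V)%MS by exact: submx_trans (submxMr j xV) Vj.
  have xkV : (x *m i *m j <= V)%MS by exact: submx_trans (submxMr j xiV) Vj.
  pose U := col_mx x (col_mx (x *m i) (col_mx (x *m j) (x *m i *m j))).
  have free (u : 'rV[R]_4) : (u *m U <= W)%MS -> u = 0.
    exact: quaternion_line_free.
  have fU : row_free U.
    rewrite -kermx_eq0; apply/eqP/row_matrixP => l; rewrite row0; apply: free.
    by rewrite -row_mul mulmx_ker row0 sub0mx.
  have capU : (W :&: U = 0)%MS.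
    apply/row_matrixP => l; rewrite row0.
    have : (row l (W :&: U) <= U)%MS by rewrite (submx_trans (row_sub _ _)) ?capmxSr.
    case/submxP => u e; rewrite e (free u) ?mul0mx // -e.
    by rewrite (submx_trans (row_sub _ _)) ?capmxSl.
  exists (W + U)%MS; last by rewrite mxrank_disjoint_sum // rW (eqP fU) mulnS addnC.
  have sU (Y : 'M[R]_n) : stablemx U Y -> stablemx W Y -> stablemx (W + U)%MS Y.
    by move=> UY WY; rewrite addsmxMr addsmxS.
  have opI m (Z : 'M[R]_(m, n)) : (Z <= U -> - Z <= U)%MS by rewrite eqmx_opp.
  have [U0 U1 U2 U3] : [/\ (x <= U)%MS, (x *m i <= U)%MS, (x *m j <= U)%MS
      & (x *m i *m j <= U)%MS].
    by have := submx_refl U; rewrite {1}/U !col_mx_sub => /and4P[].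
  split; last by rewrite addsmx_sub WV /U !col_mx_sub xV xiV xjV xkV.
    apply: sU => //; rewrite {1}/U !mul_col_mx !col_mx_sub U1 /=.
    apply/and3P; split.
    - by rewrite -mulmxA ii mulmxN mulmx1; exact: opI.
    - by rewrite -mulmxA -[j *m i]opprK -ij mulmxN mulmxA; exact: opI.
    - rewrite -!mulmxA -[j *m i]opprK -ij !mulmxN !mulmxA.
      by rewrite -[x *m i *m i]mulmxA ii mulmxN mulmx1 mulNmx opprK.
  apply: sU => //; rewrite {1}/U !mul_col_mx !col_mx_sub U2 U3 /=.
  by rewrite -!mulmxA jj !mulmxN !mulmx1 !eqmx_opp U0 U1.
have [|W [_ _ /mxrankS le] rW] := main ((\rank V + 3) %/ 4)%N; first by lia.
by apply/dvdnP; exists ((\rank V + 3) %/ 4)%N; lia.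
Qed.

Lemma quaternionic_rank_expr n (X : 'M[R]_n) k :
  quaternionic X -> (4 %| \rank (X ^+ k))%N.
Proof.
case=> i [j [ii jj ij iX jX]].
have comm (Z : 'M[R]_n) : Z *m X = X *m Z -> X ^+ k *m Z = Z *m X ^+ k.
  by move=> ZX; symmetry; apply: (@commrX _ Z X).
by apply: (quaternionic_rank ii jj ij); rewrite comm ?submxMl.
Qed.

Section ExtensionRank.
Context (d : nat) (A : 'M[R]_d).

Lemma trmx_expr (n : nat) (X : 'M[R]_n) k : (X ^+ k)^T = X^T ^+ k.
Proof. by elim: k => [|k IH]; rewrite ?expr0 ?trmx1 // exprS exprSr trmx_mul IH. Qed.

(** The image of [X ^+ k] is spanned by that of [A ^+ k] and one more vector, the image of e_0. If
    that vector adds nothing, the two images agree, and applying [X] once more keeps them equal. *)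
Lemma extension_rank a b : let X := extend_mx a b A in
  [/\ forall k, (\rank (A ^+ k) <= \rank (X ^+ k) <= (\rank (A ^+ k)).+1)%N
    & forall k, \rank (X ^+ k) = \rank (A ^+ k) ->
                \rank (X ^+ k.+1) = \rank (A ^+ k.+1)].
Proof.
(* Everything is transposed, to work with row spaces: [U] embeds the hyperplane and [f] is e_0. *)
move=> X; pose U : 'M[R]_(d, 1 + d) := row_mx 0 1%:M.
pose f : 'M[R]_(1, 1 + d) := row_mx 1%:M 0.
have UX k : U *m X^T ^+ k = A^T ^+ k *m U.
  have UX1 : U *m X^T = A^T *m U.
    rewrite /U /X /extend_mx tr_block_mx mul_row_block mul_mx_row.
    by rewrite !mul0mx !mul1mx !add0r mulmx0 mulmx1 trmx0.
  elim: k => [|k IH]; first by rewrite !expr0 mulmx1 mul1mx.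
  by rewrite !exprSr mulmxA IH -mulmxA UX1 mulmxA.
have fU : row_free U.
  apply/row_freeP; exists (col_mx 0 1%:M).
  by rewrite mul_row_col mul0mx add0r mul1mx.
have rU k : \rank (U *m X^T ^+ k) = \rank (A ^+ k).
  by rewrite UX mxrankMfree // -trmx_expr mxrank_tr.
have rX k : \rank (X^T ^+ k) = \rank (X ^+ k).
  by rewrite -trmx_expr mxrank_tr.
have full : (1%:M <= f + U)%MS.
  by rewrite addsmxE -[col_mx f U]/(block_mx _ _ _ _) -scalar_mx_block.
split=> k.
  rewrite -rX -rU mxrankS ?submxMl //=.
  have le : (X^T ^+ k <= f *m X^T ^+ k + U *m X^T ^+ k)%MS.
    by rewrite -[X in (X <= _)%MS]mul1mx -addsmxMr submxMr.
  apply: leq_trans (mxrankS le) _; apply: leq_trans (mxrank_adds_leqif _ _) _.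
  exact: (leq_add (rank_leq_row (f *m X^T ^+ k)) (leqnn _)).
rewrite -!rX -!rU => e.
have le : (X^T ^+ k <= U *m X^T ^+ k)%MS.
  have := mxrank_leqif_sup (submxMl U (X^T ^+ k)) => -[_ <-]; exact/eqP.
apply/eqP; rewrite eqn_leq mxrankS; last by rewrite !exprSr mulmxA submxMr.
by rewrite mxrankS ?submxMl.
Qed.

Lemma hypercomplex_rank : admits_hypercomplex (almost_abelian A) ->
  (forall k, (4 %| \rank (A ^+ k))%N || (4 %| (\rank (A ^+ k)).+1)%N) /\
  (forall k, (4 %| \rank (A ^+ k))%N -> (4 %| \rank (A ^+ k.+1))%N).
Proof.
case/hypercomplex_extension => a [b qX]; have [bd mono] := extension_rank a b.
have q4 k := quaternionic_rank_expr k qX.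
split=> k; have := bd k; have := q4 k; first by lia.
(* Two multiples of 4 that differ by at most 1 are equal, so [mono] applies. *)
move=> X4 bX A4; rewrite -mono ?q4 //; lia.
Qed.

End ExtensionRank.
End QuaternionicMatrices.

(** * Existence of quaternionic extensions *)

Section Existence.
Context (R : realType).

(** Two sizes are allowed so that blocks can be swapped between sizes [m + n] and [n + m] without a
    cast. *)
Lemma quaternionic_sim m n (X : 'M[R]_m) (Y : 'M[R]_n)
    (P : 'M[R]_(n, m)) (Q : 'M[R]_(m, n)) :
  P *m Q = 1%:M -> Q *m P = 1%:M -> P *m X = Y *m P ->
  quaternionic X -> quaternionic Y.
Proof.
move=> PQ QP PX [i [j [ii jj ij iX jX]]].
have YE : Y = P *m X *m Q by rewrite PX -mulmxA PQ mulmx1.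
have conjM (S T : 'M[R]_m) : P *m S *m Q *m (P *m T *m Q) = P *m (S *m T) *m Q.
  by rewrite -!mulmxA (mulmxA Q) QP mul1mx.
exists (P *m i *m Q), (P *m j *m Q); rewrite YE !conjM ij iX jX ii jj.
by split; rewrite // mulmxN mulNmx // mulmx1 PQ.
Qed.

Lemma opp_scalar_block m n :
  - 1%:M = block_mx (- 1%:M) 0 0 (- 1%:M) :> 'M[R]_(m + n).
Proof. by rewrite scalar_mx_block opp_block_mx !oppr0. Qed.

Lemma quaternionic_block_diag m n (X : 'M[R]_m) (Y : 'M[R]_n) :
  quaternionic X -> quaternionic Y -> quaternionic (block_mx X 0 0 Y).
Proof.
case=> i [j [ii jj ij iX jX]] [i' [j' [ii' jj' ij' iX' jX']]].
exists (block_mx i 0 0 i'), (block_mx j 0 0 j').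
rewrite !mulmx_block !mulmx0 !mul0mx !addr0 !add0r opp_block_mx !oppr0.
by rewrite ii jj ij iX jX ii' jj' ij' iX' jX' opp_scalar_block.
Qed.

Definition extends_quaternionic d (A : 'M[R]_d) :=
  exists a b, quaternionic (extend_mx a b A).

Lemma extends_quaternionic_sim m n (X : 'M[R]_m) (Y : 'M[R]_n)
    (P : 'M[R]_(n, m)) (Q : 'M[R]_(m, n)) :
  P *m Q = 1%:M -> Q *m P = 1%:M -> P *m X = Y *m P ->
  extends_quaternionic X -> extends_quaternionic Y.
Proof.
move=> PQ QP PX [a [b qX]]; exists a, (P *m b); move: qX.
apply: (@quaternionic_sim _ _ _ _ (block_mx 1%:M 0 0 P) (block_mx 1%:M 0 0 Q)).
- by rewrite mulmx_block !mulmx0 !mul0mx !addr0 !add0r mulmx1 PQ -scalar_mx_block.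
- by rewrite mulmx_block !mulmx0 !mul0mx !addr0 !add0r mulmx1 QP -scalar_mx_block.
by rewrite !mulmx_block !mulmx0 !mul0mx !addr0 !add0r !mulmx1 !mul1mx PX.
Qed.

Lemma extends_quaternionic_dsuml m n (X : 'M[R]_m) (Y : 'M[R]_n) :
  extends_quaternionic X -> quaternionic Y ->
  extends_quaternionic (block_mx X 0 0 Y).
Proof.
case=> a [b qX] qY; exists a, (col_mx b 0).
have := quaternionic_block_diag qX qY.
congr quaternionic.
(* The vector e_0 joins the block of [X]; the sizes [1 + (m + n)] and [1 + m + n] are convertible,
   so the cast from reassociating disappears. *)
have := block_mxA (A11 := a%:M) (A12 := 0 : 'M_(1, m)) (A13 := 0 : 'M_(1, n))
  (A21 := b) (A22 := X) (A23 := 0) (A31 := 0) (A32 := 0) (A33 := Y).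
by rewrite /= !row_mx0 col_mx0 castmx_id => h; apply: esym.
Qed.

Lemma extends_quaternionic_dsumr m n (X : 'M[R]_m) (Y : 'M[R]_n) :
  quaternionic X -> extends_quaternionic Y ->
  extends_quaternionic (block_mx X 0 0 Y).
Proof.
move=> qX qY; have := extends_quaternionic_dsuml qY qX.
have swap k l : block_mx 0 1%:M 1%:M 0 *m block_mx 0 1%:M 1%:M 0
    = 1%:M :> 'M[R]_(k + l, k + l).
  by rewrite mulmx_block !mulmx0 !mul0mx !addr0 !add0r !mulmx1 -scalar_mx_block.
apply: (extends_quaternionic_sim (swap m n) (swap n m)).
by rewrite !mulmx_block !mulmx0 !mul0mx !addr0 !add0r !mulmx1 !mul1mx.
Qed.

(** With [I] a rotation of the plane by a right angle, take [i = diag(I, - I)] and let [j] exchange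
    the two planes up to sign. *)
Lemma quaternion_units : exists i j : 'M[R]_4,
  [/\ i *m i = - 1%:M, j *m j = - 1%:M & i *m j = - (j *m i)].
Proof.
have [I II] : exists I : 'M[R]_(1 + 1), I *m I = - 1%:M.
  exists (block_mx 0 (- 1%:M) 1%:M 0).
  rewrite mulmx_block !mulmx0 !mul0mx !addr0 !add0r mulmx1 mul1mx.
  by rewrite -opp_scalar_block.
pose i : 'M[R]_((1 + 1) + (1 + 1)) := block_mx I 0 0 (- I).
pose j : 'M[R]_((1 + 1) + (1 + 1)) := block_mx 0 (- 1%:M) 1%:M 0.
have ii : i *m i = - 1%:M.
  rewrite /i mulmx_block !mulmx0 !mul0mx !addr0 !add0r mulmxN mulNmx opprK II.
  by rewrite -opp_scalar_block.
have jj : j *m j = - 1%:M.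
  rewrite /j mulmx_block !mulmx0 !mul0mx !addr0 !add0r mulmx1 mul1mx.
  by rewrite -opp_scalar_block.
have ij : i *m j = - (j *m i).
  rewrite /i /j !mulmx_block !mulmx0 !mul0mx !addr0 !add0r.
  by rewrite !mulmxN !mulNmx !mulmx1 !mul1mx opp_block_mx !oppr0 opprK.
by exists i, j.
Qed.

(** The matrix is the tensor product of a shift by 1 with [I_4], and the quaternions act on the
    second factor. *)
Lemma quaternionic_block_subdiag k :
  (4 %| k)%N -> quaternionic (block_subdiag R k).
Proof.
case/dvdnP => q ->; have [i [j [ii jj ij]]] := quaternion_units.
have S : block_subdiag R (q * 4) =
    tensmx (\matrix_(a, b) (a == b.+1 :> nat)%:R : 'M[R]_q) (1%:M : 'M[R]_4).
  apply/matrixP => a b; rewrite mxE.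
  case: (mxtens_indexP a) => a1 a2; case: (mxtens_indexP b) => b1 b2.
  rewrite tensmxE !mxE -natrM mulnb /=; congr (_%:R); congr nat_of_bool.
  by rewrite -val_eqE /=; have := ltn_ord a2; have := ltn_ord b2; lia.
have t1 : tensmx (1%:M : 'M[R]_q) (1%:M : 'M[R]_4) = 1%:M.
  apply/matrixP => a b; rewrite [RHS]mxE.
  case: (mxtens_indexP a) => a1 a2; case: (mxtens_indexP b) => b1 b2.
  rewrite tensmxE !mxE -natrM mulnb; congr (_%:R); congr nat_of_bool.
  by rewrite -!val_eqE /=; have := ltn_ord a2; have := ltn_ord b2; lia.
have tN (X : 'M[R]_4) : tensmx (1%:M : 'M[R]_q) (- X) = - tensmx 1%:M X.
  by apply/matrixP => a b; rewrite !mxE mulrN.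
rewrite S; exists (tensmx 1%:M i), (tensmx 1%:M j).
by rewrite !tensmx_mul !mulmx1 !mul1mx ii jj ij !tN t1.
Qed.

Lemma extends_quaternionic_block_subdiag d :
  (4 %| d.+1)%N -> extends_quaternionic (block_subdiag R d).
Proof.
(* Dropping the first basis vector from the shift of size [d + 1] leaves the shift of size [d]. The
   dropped vector goes to the one of index 4, which has index 3 among the others; for [d = 3] this
   column is zero. *)
move=> d4; exists 0, (\col_i (i == 3 :> nat)%:R).
suff <- : block_subdiag R (1 + d) = extend_mx 0 (\col_i (i == 3 :> nat)%:R)
    (block_subdiag R d).
  exact: quaternionic_block_subdiag.
apply/matrixP => a b; rewrite /extend_mx.
case: (split_ordP a) => a' ->; case: (split_ordP b) => b' ->.
- by rewrite block_mxEul !mxE !ord1 mul0rn.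
- by rewrite block_mxEur !mxE ord1.
- by rewrite block_mxEdl !mxE ord1.
- by rewrite block_mxEdr !mxE.
Qed.

End Existence.

(** * Ranks of powers of the matrices of the classification *)

Lemma nat_recurrence_unique (f g : nat -> nat) (K : nat) :
  (forall k, (K <= k)%N -> f k = 0%N) -> (forall k, (K <= k)%N -> g k = 0%N) ->
  (forall k, f k + f k.+2 + 2 * g k.+1 = g k + g k.+2 + 2 * f k.+1)%N -> f =1 g.
Proof.
move=> f0 g0 fg k.
suff main j : (f (K - j) = g (K - j) /\ f (K - j).+1 = g (K - j).+1)%N.
  have [Kk|/ltnW kK] := leqP K k; first by rewrite f0 ?g0.
  by have [] := main (K - k)%N; rewrite subKn.
elim: j => [|j [IH1 IH2]]; first by rewrite subn0 !f0 ?g0.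
have [Kj|jK] := leqP K j.
  by move: IH1 IH2; rewrite (_ : K - j.+1 = K - j)%N //; lia.
have e : (K - j = (K - j.+1).+1)%N by lia.
rewrite -e; split => //; have := fg (K - j.+1)%N; rewrite -e; lia.
Qed.

(** With truncated subtraction, k -> m - k is convex with a single kink, at k = m. *)
Lemma second_difference (I : finType) (m p : I -> nat) k :
  (\sum_i p i * (m i - k) + \sum_i p i * (m i - k.+2) =
   2 * (\sum_i p i * (m i - k.+1)) + \sum_i p i * (m i == k.+1))%N.
Proof.
rewrite big_distrr -!big_split; apply: eq_bigr => i _ /=.
have : ((m i - k) + (m i - k.+2) = 2 * (m i - k.+1) + (m i == k.+1))%N.
  by case: eqP; lia.
nia.
Qed.

Section RankProfile.
Context (R : realType).
Implicit Types X Y : sqmx R.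

Definition power_rank k X := \rank (tagged X ^+ k).

Lemma block_diag_expr m n (A : 'M[R]_m) (B : 'M[R]_n) k :
  block_mx A 0 0 B ^+ k = block_mx (A ^+ k) 0 0 (B ^+ k).
Proof.
elim: k => [|k IH]; first by rewrite !expr0 -scalar_mx_block.
rewrite !exprS IH -[LHS]/(_ *m _) mulmx_block.
by rewrite !mulmx0 !mul0mx !addr0 !add0r.
Qed.

Lemma power_rank_dsum k X Y :
  power_rank k (dsum X Y) = (power_rank k X + power_rank k Y)%N.
Proof. by rewrite /power_rank block_diag_expr rank_diag_block_mx. Qed.

Lemma power_rank_zeromx k n : power_rank k (zeromx R n) = (n * (1 - k))%N.
Proof.
case: k => [|k]; first by rewrite /power_rank expr0 mxrank1 muln1.
by rewrite /power_rank expr0n mxrank0 muln0.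
Qed.

Lemma rank_shift d c :
  \rank (\matrix_(i < d, j < d) ((i : nat) == (j + c)%N)%:R : 'M[R]_d) = (d - c)%N.
Proof.
have [dc|cd] := leqP d c.
  rewrite (_ : \matrix_(i, j) _ = 0) ?mxrank0; first by lia.
  apply/matrixP => i j; rewrite !mxE; case: eqP => // e.
  by have := ltn_ord i; lia.
have [e ->] : exists e, d = (c + e)%N by exists (d - c)%N; lia.
rewrite addKn (_ : \matrix_(i, j) _ = col_mx 0 (pid_mx e)).
  by rewrite -addsmxE adds0mx rank_pid_mx // leq_addl.
apply/matrixP => i j; case: (split_ordP i) => i' ->;
  rewrite ?col_mxEu ?col_mxEd !mxE /=.
  by case: eqP => // h; have := ltn_ord i'; lia.
rewrite ltn_ord andbT; congr (_%:R); congr nat_of_bool; lia.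
Qed.

(** The [k]-th power is the shift by [4 * k]. *)
Lemma power_rank_block_subdiag k d :
  power_rank k (pack (block_subdiag R d)) = (d - 4 * k)%N.
Proof.
rewrite -(rank_shift d (4 * k)) /power_rank /=; congr (\rank _).
elim: k => [|k IH].
  by apply/matrixP => i j; rewrite expr0 -[1]/(1%:M) !mxE muln0 addn0.
rewrite exprS IH; apply/matrixP => i j; rewrite !mxE.
under eq_bigr do rewrite !mxE -natrM mulnb.
have [lt|ge] := ltnP (j + 4 * k) d.
  rewrite (bigD1 (Ordinal lt)) //= eqxx andbT big1 ?addr0.
    by congr (_%:R); congr nat_of_bool; lia.
  by move=> l; rewrite -val_eqE /= => /negPf ->; rewrite andbF.
rewrite big1 => [|l _].
  by case: eqP => // e; have := ltn_ord i; lia.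
by case: andP => // -[_ /eqP e]; have := ltn_ord l; lia.
Qed.

Lemma border_U_subdiag k :
  border_U (block_subdiag R (4 + k)) = pack (block_subdiag R (3 + (4 + k))).
Proof.
congr pack; apply/matrixP => i j.
case: (split_ordP i) => i' ->; case: (split_ordP j) => j' ->.
- by rewrite block_mxEul !mxE; case: eqP => //= e; have := ltn_ord i'; lia.
- by rewrite block_mxEur !mxE; case: eqP => //= e; have := ltn_ord i'; lia.
- rewrite block_mxEdl; case: (split_ordP i') => i1 ->.
    by rewrite col_mxEu !mxE; congr (_%:R); congr nat_of_bool => /=; lia.
  rewrite col_mxEd !mxE; case: eqP => //= e; have := ltn_ord j'; lia.
- by rewrite block_mxEdr !mxE; congr (_%:R); congr nat_of_bool => /=; lia.
Qed.

(** Here [Umx] is the only nonzero block, and it is also all there is in the shift of size 7 = 3 +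
    4. *)
Lemma N0mx_dsum s :
  N0mx R s = dsum (pack (block_subdiag R 7)) (zeromx R (4 * (s - 1))).
Proof.
rewrite /N0mx /border_U /dsum /zeromx /=.
move: (4 * (s - 1))%N => k; rewrite /pack; congr Tagged.
have -> : block_subdiag R 7 = block_mx 0 0 (Umx R) 0 :> 'M[R]_(3 + 4).
  apply/matrixP => i j.
  case: (@split_ordP 3 4 i) => i' ->; case: (@split_ordP 3 4 j) => j' ->.
  - by rewrite block_mxEul !mxE; case: eqP => //= e; have := ltn_ord i'; lia.
  - by rewrite block_mxEur !mxE; case: eqP => //= e; have := ltn_ord i'; lia.
  - by rewrite block_mxEdl !mxE; congr (_%:R); congr nat_of_bool => /=; lia.
  - by rewrite block_mxEdr !mxE; case: eqP => //= e; have := ltn_ord i'; lia.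
have := block_mxA (A11 := 0 : 'M[R]_3) (A12 := 0 : 'M_(3, 4))
  (A13 := 0 : 'M_(3, k)) (A21 := Umx R) (A22 := 0 : 'M_4) (A23 := 0 : 'M_(4, k))
  (A31 := 0 : 'M_(k, 3)) (A32 := 0) (A33 := 0).
by rewrite /= !row_mx0 col_mx0 block_mx0 castmx_id.
Qed.

End RankProfile.

(** * Rank profiles and quaternionic extensions of the listed matrices *)

Section SigmaMembers.
Context (R : realType).

Definition sq_quaternionic (X : sqmx R) := quaternionic (tagged X).
Definition sq_extends (X : sqmx R) := extends_quaternionic (tagged X).

Lemma sq_quaternionic_zeromx k : (4 %| k)%N -> sq_quaternionic (zeromx R k).
Proof.
move=> k4; have [i [j [ii jj ij _ _]]] := quaternionic_block_subdiag R k4.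
by exists i, j; rewrite /= !mulmx0 !mul0mx.
Qed.

Lemma sq_quaternionic_copies q X :
  sq_quaternionic X -> sq_quaternionic (dsum_copies q X).
Proof.
move=> qX; elim: q => [|q IH]; first exact: sq_quaternionic_zeromx.
exact: quaternionic_block_diag.
Qed.

Section Tuple.
Context (r : nat) (m p : 'I_r -> nat) (s : nat).

Lemma sq_quaternionic_Jsum P : sq_quaternionic (Jsum R m p P).
Proof.
apply: big_ind; first exact: sq_quaternionic_zeromx.
  by move=> X Y; exact: quaternionic_block_diag.
move=> i _; apply: sq_quaternionic_copies.
by apply: quaternionic_block_subdiag; rewrite dvdn_mulr.
Qed.

(* The numbers b_k: each matrix M attached to the tuple has rank
   4 qrank k + 3 [k <= l], with l given by [odd_block]. *)
Definition qrank k := (\sum_i p i * (m i - k) + s * (1 - k))%N.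

(* As a direct sum of shifts, X has exactly one summand of size 3 mod 4; its
   size is 4 l + 3. *)
Definition odd_block (X : sqmx R) (l : nat) : Prop :=
  [\/ X = A_first R m p s /\ l = 0%N,
      exists2 i, X = A_mid R m p s i & l = m i
    | [/\ (0 < s)%N, X = A_last R m p s & l = 1%N]].

Lemma power_rank_copies k q (X : sqmx R) :
  power_rank k (dsum_copies q X) = (q * power_rank k X)%N.
Proof.
elim: q => [|q IH]; first by rewrite power_rank_zeromx.
by rewrite [dsum_copies _ _]/(dsum X _) power_rank_dsum IH mulSn.
Qed.

Lemma power_rank_Jsum k P :
  power_rank k (Jsum R m p P) = (\sum_(i | P i) 4 * (p i * (m i - k)))%N.
Proof.
rewrite (big_morph _ (power_rank_dsum k) (power_rank_zeromx R k 0)) mul0n.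
apply: eq_bigr => i _; rewrite power_rank_copies power_rank_block_subdiag; lia.
Qed.

Lemma Nmx_dsum (a q : nat) : (0 < a)%N ->
  Nmx R a q = dsum (pack (block_subdiag R (4 * a + 3)))
                   (dsum_copies (q - 1) (Jmx R a)).
Proof.
move=> a0; rewrite /Nmx border_U_subdiag; congr (dsum (pack (block_subdiag R _)) _).
by lia.
Qed.

Lemma odd_block_power_rank N X l k : in_Sigma m p s N -> odd_block X l ->
  power_rank k X = (4 * qrank k + 3 * (k <= l)%N)%N.
Proof.
case=> _ _ m2 p0 _; have Jall : power_rank k (Jsum R m p predT) =
    (4 * \sum_i p i * (m i - k))%N.
  by rewrite power_rank_Jsum big_distrr.
rewrite /qrank; case=> [[-> ->]|[l0 -> ->]|[s0 -> ->]].
- rewrite /A_first !power_rank_dsum Jall !power_rank_zeromx.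
  by case: k {Jall} => [|k]; lia.
- rewrite /A_mid !power_rank_dsum !power_rank_Jsum.
  (* The repeated rewriting has also split [Nmx]; it is folded back to exhibit its shift of size 4 m
     + 3. *)
  rewrite -power_rank_dsum -/(Nmx R _ _) Nmx_dsum; last exact: ltnW.
  rewrite power_rank_dsum power_rank_copies !power_rank_block_subdiag.
  rewrite power_rank_zeromx.
  have -> : (\sum_i p i * (m i - k) = p l0 * (m l0 - k) + (
      \sum_(i < r | (i < l0)%N) p i * (m i - k) +
      \sum_(i < r | (l0 < i)%N) p i * (m i - k)))%N.
    rewrite (bigD1 l0) //= (bigID (fun i : 'I_r => (i < l0)%N)) /=; congr (_ + (_ + _))%N;
      apply: eq_bigl => i; rewrite -val_eqE /=; lia.
  rewrite -!big_distrr /=; have := p0 l0; have := m2 l0.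
  case: (p l0) => // q; nia.
rewrite /A_last power_rank_dsum Jall N0mx_dsum power_rank_dsum.
rewrite power_rank_block_subdiag power_rank_zeromx.
by case: k {Jall} => [|[|k]]; lia.
Qed.

(** The summand of size 3 mod 4 absorbs e_0, and all other summands are already quaternionic. *)
Lemma odd_block_extends N X l : in_Sigma m p s N -> odd_block X l ->
  sq_extends X.
Proof.
have q4 k : sq_quaternionic (zeromx R (4 * k)).
  by apply: sq_quaternionic_zeromx; rewrite dvdn_mulr.
have qJ k : sq_quaternionic (Jmx R k).
  by apply: quaternionic_block_subdiag; rewrite dvdn_mulr.
have e3 k : sq_extends (pack (block_subdiag R (4 * k + 3))).
  by apply: extends_quaternionic_block_subdiag; rewrite -addnS dvdn_addr ?dvdn_mulr.
case=> _ _ m2 _ _ [[-> _]|[l0 -> _]|[s0 -> _]].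
- apply: extends_quaternionic_dsuml.
    have [a [b [i [j [ii jj ij _ _]]]]] := e3 0%N.
    by exists 0, 0, i, j; rewrite /extend_mx /= raddf0 block_mx0 !mulmx0 !mul0mx.
  by apply: quaternionic_block_diag (q4 s); exact: sq_quaternionic_Jsum.
- apply: extends_quaternionic_dsumr; first exact: sq_quaternionic_Jsum.
  apply: extends_quaternionic_dsuml; last first.
    by apply: quaternionic_block_diag (q4 s); exact: sq_quaternionic_Jsum.
  rewrite -/(sq_extends (Nmx R _ _)) Nmx_dsum; last exact: ltnW.
  by apply: extends_quaternionic_dsuml (e3 _) _; exact: sq_quaternionic_copies.
- apply: extends_quaternionic_dsumr; first exact: sq_quaternionic_Jsum.
  rewrite -/(sq_extends (N0mx R s)) N0mx_dsum.
  by apply: extends_quaternionic_dsuml (e3 1%N) (q4 _).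
Qed.

Lemma in_Sigma_inj N : in_Sigma m p s N -> injective m.
Proof.
case=> _ mlt _ _ _ i j mij; apply/val_inj/eqP; rewrite eqn_leq.
by apply/andP; split; rewrite leqNgt; apply/negP => /mlt; rewrite mij ltnn.
Qed.

(** The values 0, 1 and [m i >= 2] of [l] tell the three cases apart, and [m] is injective. *)
Lemma odd_block_inj N X Y l : in_Sigma m p s N ->
  odd_block X l -> odd_block Y l -> X = Y.
Proof.
move=> S; have mi := in_Sigma_inj S; case: S => _ _ m2 _ _.
case=> [[-> ->]|[i -> ->]|[_ -> ->]] [[-> h]|[i' -> h]|[_ -> h]] //.
- by have := m2 i'; rewrite -h.
- by have := m2 i; rewrite h.
- by rewrite (mi _ _ h).
- by have := m2 i; rewrite h.
- by have := m2 i'; rewrite -h.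
Qed.

(** The zero block of size [4 * s] counts as [s] blocks with m = 1, whose kink is at 1. *)
Lemma qrank_second_difference k :
  (qrank k + qrank k.+2 = 2 * qrank k.+1 +
    (\sum_i p i * (m i == k.+1) + s * (k == 0)))%N.
Proof.
rewrite /qrank; have := second_difference m p k.
case: k => [|k] /=; lia.
Qed.

Lemma qrank_eventually0 : exists K, forall k, (K <= k)%N -> qrank k = 0%N.
Proof.
exists (\sum_i m i).+1 => k Kk; rewrite /qrank big1 ?add0n; first by lia.
move=> i _; suff : (m i <= \sum_i m i)%N by nia.
by rewrite (bigD1 i) //= leq_addr.
Qed.

End Tuple.
End SigmaMembers.

(** * Classification *)

Section Classification.
Context (R : realType).

Lemma multiplicity_support r (m p : 'I_r -> nat) s N k : in_Sigma m p s N ->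
  (k \in codom m) = (0 < \sum_i p i * (m i == k))%N.
Proof.
case=> _ _ _ p0 _; apply/codomP/idP => [[i ->]|].
  by rewrite (bigD1 i) //= eqxx muln1 ltn_addr.
rewrite lt0n sum_nat_eq0 => /forallPn[i]; rewrite muln_eq0 negb_or => /andP[_].
by rewrite eqb0 negbK => /eqP <-; exists i.
Qed.

Lemma codom_sorted r (m p : 'I_r -> nat) s N : in_Sigma m p s N ->
  sorted gtn (codom m).
Proof.
case=> _ mlt _ _ _.
have : sorted (relpre (@nat_of_ord r) ltn) (enum 'I_r).
  by rewrite -sorted_map val_enum_ord iota_ltn_sorted.
by apply: homo_sorted => i j; exact: mlt.
Qed.

Lemma multiplicity_eq r (m p : 'I_r -> nat) s r' (m' p' : 'I_r' -> nat) s' N N' :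
  in_Sigma m p s N -> in_Sigma m' p' s' N' ->
  qrank m p s =1 qrank m' p' s' ->
  forall k, (\sum_i p i * (m i == k) = \sum_i p' i * (m' i == k))%N.
Proof.
have ge2 q (f g : 'I_q -> nat) t M j : in_Sigma f g t M -> (j < 2)%N ->
    (\sum_i g i * (f i == j) = 0)%N.
  case=> _ _ f2 _ _ j2; rewrite big1 // => i _; have := f2 i.
  by case: eqP => [->|_ _]; rewrite ?muln0 // leqNgt j2.
move=> S S' e k; have [k2|] := ltnP k 2.
  by rewrite (ge2 _ _ _ _ _ _ S) ?(ge2 _ _ _ _ _ _ S').
case: k => [|[|k]] // _; have := qrank_second_difference m p s k.+1.
have := qrank_second_difference m' p' s' k.+1; rewrite !e; lia.
Qed.

(** The second differences give the multiplicity of each value. A strictly decreasing list is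
    determined by its members, which yields [r] and [m]; the multiplicities yield [p], and the value
    at 0 yields [s]. *)
Lemma odd_block_unique r (m p : 'I_r -> nat) s N X
    r' (m' p' : 'I_r' -> nat) s' N' (Y : sqmx R) l :
  in_Sigma m p s N -> in_Sigma m' p' s' N' ->
  qrank m p s =1 qrank m' p' s' ->
  odd_block m p s X l -> odd_block m' p' s' Y l -> X = Y.
Proof.
move=> S S' e oX; have mult := multiplicity_eq S S' e.
have em : codom m = codom m'.
  apply: (irr_sorted_eq _ _ (codom_sorted S) (codom_sorted S')).
  - by move=> a b c /= ab bc; exact: ltn_trans bc ab.
  - by move=> a; exact: ltnn.
  by move=> k; rewrite (multiplicity_support _ S) (multiplicity_support _ S') mult.
have er : r = r' by move/(congr1 size): em; rewrite !size_codom !card_ord.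
case: _ / er in m' p' S' e mult em *.
have {}em : m' = m.
  by apply/funext => i; move/eq_in_map: (esym em) => -> //; rewrite mem_enum.
have ep : p' = p.
  apply/funext => i; have := mult (m i); rewrite em.
  have one (q : 'I_r -> nat) : (\sum_j q j * (m j == m i) = q i)%N.
    rewrite (bigD1 i) //= eqxx muln1 big1 ?addn0 // => j ji.
    by rewrite (inj_eq (in_Sigma_inj S)) (negPf ji) muln0.
  by rewrite !one.
have es : s' = s.
  by have := e 0%N; rewrite em ep /qrank => /addnI; rewrite !muln1.
by rewrite em ep es; exact: odd_block_inj S oX.
Qed.

Lemma odd_block_exists (rk : nat -> nat) (K n : nat) :
  (forall k, 2 * rk k.+1 <= rk k + rk k.+2)%N ->
  (forall k, (K <= k)%N -> rk k = 0%N) ->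
  (forall k, (4 %| rk k)%N || (4 %| (rk k).+1)%N) ->
  (forall k, (4 %| rk k)%N -> (4 %| rk k.+1)%N) ->
  rk 0 = (4 * n + 3)%N -> (4 <= rk 1)%N ->
  exists r (m p : 'I_r -> nat) s l (X : sqmx R),
    [/\ in_Sigma m p s n, odd_block m p s X l & forall k, power_rank k X = rk k].
Proof.
move=> conv rk0 mod4 mono rkn rk1; pose b k := (rk k %/ 4)%N.
have [l el] : exists l, forall k, (rk k = 4 * b k + 3 * (k <= l))%N.
  have ex : exists k, (4 %| rk k)%N by exists K; rewrite rk0.
  (* [l0] is the first exponent with [rk] divisible by 4; it is positive as [rk 0 = 4 * n + 3], and
     [mono] keeps the divisibility from there on. *)
  case: (ex_minnP ex) => l0 div0 min0; exists l0.-1 => k.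
  have [kl0|l0k] := ltnP k l0.
    have ndiv : ~~ (4 %| rk k)%N by apply/negP => /min0; rewrite leqNgt kl0.
    have -> : (k <= l0.-1)%N by lia.
    by have := mod4 k; rewrite (negPf ndiv) /b /=; lia.
  have l0_gt0 : (0 < l0)%N.
    by rewrite lt0n; apply: contraTneq div0 => ->; rewrite rkn; lia.
  have -> : (k <= l0.-1)%N = false by lia.
  have : (4 %| rk k)%N.
    rewrite -(subnKC l0k); elim: (k - l0)%N => [|j IH]; rewrite ?addn0 // addnS.
    exact: mono.
  by rewrite /b; lia.
(* The terms 3 [k <= l] disturb the convexity of [4 * b] by at most 3, which integrality absorbs. *)
have bconv k : (2 * b k.+1 <= b k + b k.+2)%N.
  have := conv k; rewrite !el.
  by case: (leqP k l); case: (leqP k.+1 l); case: (leqP k.+2 l); lia.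
pose beta k := (b k.-1 + b k.+1 - 2 * b k)%N.
have betaE k : (b k + b k.+2 = 2 * b k.+1 + beta k.+1)%N.
  by have := bconv k; rewrite /beta /=; lia.
have b0 k : (K <= k)%N -> b k = 0%N by move=> Kk; rewrite /b rk0.
have beta0 k : (K < k)%N -> beta k = 0%N.
  by move=> Kk; rewrite /beta !b0 //; lia.
(* The range 2, ..., K + 1 is long enough, since [beta] vanishes beyond [K]; reversing makes the
   list decreasing. *)
pose ms := rev [seq k <- iota 2 K | (0 < beta k)%N].
have mem_ms k : (k \in ms) = (2 <= k)%N && (0 < beta k)%N.
  rewrite mem_rev mem_filter mem_iota andbC.
  case: (ltnP K k) => [/beta0 ->|]; first by rewrite !andbF.
  by case: (0 < beta k)%N; lia.
have uniq_ms : uniq ms by rewrite rev_uniq filter_uniq ?iota_uniq.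
have sorted_ms : sorted gtn ms.
  rewrite rev_sorted; apply: sorted_filter (iota_ltn_sorted _ _).
  exact: ltn_trans.
pose m (i : 'I_(size ms)) := nth 0%N ms i; pose p i := beta (m i).
pose s := beta 1.
have mP i : m i \in ms by apply: mem_nth.
have mult k : (\sum_i p i * (m i == k) = if k \in ms then beta k else 0)%N.
  rewrite -(big_mkord xpredT (fun i => beta (nth 0%N ms i) * (nth 0%N ms i == k))%N).
  rewrite -(big_nth 0%N xpredT (fun x => beta x * (x == k))%N).
  case: ifP => [kms|/negP kms].
    rewrite (bigD1_seq k) //= eqxx muln1 big1 ?addn0 // => x /negPf ->.
    by rewrite muln0.
  rewrite big_seq big1 // => x xms; case: eqP => [xk|]; last by rewrite muln0.
  by case: kms; rewrite -xk.
have qb : qrank m p s =1 b.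
  have [K' q0] := qrank_eventually0 m p s.
  apply: (@nat_recurrence_unique _ _ (K + K')) => k.
  - by move=> Kk; apply: q0; lia.
  - by move=> Kk; apply: b0; lia.
  rewrite qrank_second_difference mult mem_ms betaE.
  by case: k => [|k] /=; rewrite -/s; [lia | case: posnP; lia].
(* At [l] the terms 3 [k <= l] form a concave kink, which [b] must outweigh for [rk] to be
   convex. *)
have beta_l : (0 < l)%N -> (0 < beta l)%N.
  case: l el => // l el _; have := conv l; rewrite !el leqnn leqW // ltnn /beta /=.
  lia.
have S : in_Sigma m p s n.
  split.
  (* Without any [m i] the value [b 1] would be 0, against [4 <= rk 1]. *)
  - rewrite lt0n; apply/eqP => sz0.
    have := qb 1%N; rewrite /qrank big1 => [|i _]; last by have := ltn_ord i; lia.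
    by rewrite /b; lia.
  - move=> i j ij; apply: (sorted_ltn_nth _ 0%N sorted_ms) => //.
    + by move=> x y z /= xy yz; exact: ltn_trans yz xy.
    + by rewrite inE.
    + by rewrite inE.
  - by move=> i; have := mP i; rewrite mem_ms => /andP[].
  - by move=> i; have := mP i; rewrite mem_ms => /andP[].
  have := qb 0%N; rewrite /qrank /b rkn muln1.
  under eq_bigr do rewrite subn0 mulnC.
  by move=> ->; lia.
have [X oX] : exists X : sqmx R, odd_block m p s X l.
  have [l0|l_gt0] := posnP l.
    by exists (A_first R m p s); constructor 1.
  have [l1|l_neq1] := eqVneq l 1%N.
    exists (A_last R m p s); constructor 3; split=> //.
    by have := beta_l l_gt0; rewrite l1.
  have : l \in ms by rewrite mem_ms beta_l // andbT; lia.
  move=> lms; have lt : (index l ms < size ms)%N by rewrite index_mem.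
  exists (A_mid R m p s (Ordinal lt)); constructor 2; exists (Ordinal lt) => //.
  by rewrite /m /= nth_index.
exists (size ms), m, p, s, l, X; split=> // k.
by rewrite (odd_block_power_rank _ S oX) qb -el.
Qed.

End Classification.

Lemma qrank1_gt0 r (m p : 'I_r -> nat) s N :
  in_Sigma m p s N -> (0 < qrank m p s 1)%N.
Proof.
case=> r0 _ m2 p0 _; rewrite /qrank (bigD1 (Ordinal r0)) //= -addnA ltn_addr //.
by rewrite muln_gt0 p0 subn_gt0 m2.
Qed.

(** * From rank profiles to isomorphism classes *)

Section Main.
Context (R : realType).

(** This is the Frobenius inequality for the product of [A], [A ^+ k] and [A]. *)
Lemma power_rank_convex (d : nat) (A : 'M[R]_d) k :
  (2 * \rank (A ^+ k.+1) <= \rank (A ^+ k) + \rank (A ^+ k.+2))%N.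
Proof.
have := mxrank_Frobenius A (A ^+ k) A.
have AA (X Y : 'M[R]_d) : X *m Y = X * Y by [].
by rewrite !AA -exprSr -exprS -exprSr mulSn mul1n.
Qed.

Lemma power_rank_decr (d : nat) (A : 'M[R]_d) k :
  (\rank (A ^+ k.+1) <= \rank (A ^+ k))%N.
Proof. by rewrite exprS mxrankM_maxr. Qed.

(** The sizes may differ as terms, as for [N0mx]; the zeroth powers show that they are equal. *)
Lemma same_ranks_isomorphic (d e : nat) (A : 'M[R]_d) (B : 'M[R]_e) K :
  A ^+ K = 0 -> (forall k, \rank (A ^+ k) = \rank (B ^+ k)) ->
  lie_isomorphic (almost_abelian A) (almost_abelian B).
Proof.
move=> AK rk; have := rk 0%N; rewrite !expr0 !mxrank1 => de.
case: _ / de in B rk *.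
have BK : B ^+ K = 0 by apply/eqP; rewrite -mxrank_eq0 -rk AK mxrank0.
have rk' k : \rank (B ^+ k) = \rank (A ^+ k) by [].
have [Q uQ QAB] := nilpotent_similar BK AK rk'.
exact: lie_isomorphic_aa_similar uQ QAB.
Qed.

Lemma tildeSigmaP N d (M : 'M[R]_d) : M \in @tildeSigma R N d <->
  exists r (m p : 'I_r -> nat) s l,
    in_Sigma m p s N /\ odd_block m p s (pack M) l.
Proof.
rewrite inE; split.
  case=> r [m [p [s [S [e|[i e]|[s0 e]]]]]]; exists r, m, p, s.
  - by exists 0%N; split=> //; constructor 1.
  - by exists (m i); split=> //; constructor 2; exists i.
  - by exists 1%N; split=> //; constructor 3.
case=> r [m [p [s [l [S oM]]]]]; exists r, m, p, s; split=> //.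
case: oM => [[e _]|[i e _]|[s0 e _]].
- by constructor 1.
- by constructor 2; exists i.
- by constructor 3.
Qed.

Lemma tildeSigma_exists d n (rk : nat -> nat) K :
  (forall k, 2 * rk k.+1 <= rk k + rk k.+2)%N ->
  (forall k, (K <= k)%N -> rk k = 0%N) ->
  (forall k, (4 %| rk k)%N || (4 %| (rk k).+1)%N) ->
  (forall k, (4 %| rk k)%N -> (4 %| rk k.+1)%N) ->
  rk 0 = d -> d = (4 * n + 3)%N -> (4 <= rk 1)%N ->
  exists2 M : 'M[R]_d, M \in @tildeSigma R n d &
    forall k, \rank (M ^+ k) = rk k.
Proof.
move=> conv rk0 mod4 mono rkd dn rk1.
have [|r [m [p [s [l [[d' M] [S oM rkM]]]]]]] :=
  odd_block_exists R conv rk0 mod4 mono (n := n) _ rk1; first by rewrite rkd.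
have d'd : d' = d by rewrite -rkd -rkM /power_rank /= expr0 mxrank1.
case: _ / d'd rkd dn => rkd dn; exists M => //.
by apply/tildeSigmaP; exists r, m, p, s, l.
Qed.

End Main.

Theorem corollary4p6 (R : realType) (n : nat) (hn : (2 <= n)%N) :
  set_bij (@tildeSigma R (n - 1) (4 * n - 1))
    (@hypercomplex_nilpotent_classes R n)
    (@iso_class R (4 * n - 1))
  /\
  (forall A : 'M[R]_(4 * n - 1),
     lie_nilpotent (almost_abelian A) ->
     admits_hypercomplex (almost_abelian A) ->
     dim_ker A = (4 * (n - 1))%N ->
     lie_isomorphic (almost_abelian A)
       (almost_abelian (tagged (N0mx R (n - 1))))).
Proof.
have eventually0 (d : nat) (A : 'M[R]_d) : lie_nilpotent (almost_abelian A) ->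
    exists2 K, A ^+ K = 0 & forall k, (K <= k)%N -> \rank (A ^+ k) = 0%N.
  case/lie_nilpotent_aa => K AK; exists K => // k Kk.
  by rewrite -(subnK Kk) exprD AK mulr0 mxrank0.
have iso_classP (d : nat) (A B : 'M[R]_d) :
    lie_isomorphic (almost_abelian A) (almost_abelian B) ->
    iso_class A = iso_class B.
  move=> iso; apply/seteqP; split => X /= iX.
    exact: lie_isomorphic_trans iX iso.
  exact: lie_isomorphic_trans iX (lie_isomorphic_sym iso).
split; last first.
  move=> A nilA hcA; have [K AK A0] := eventually0 _ _ nilA.
  have [mod4 mono] := hypercomplex_rank hcA.
  rewrite dim_kerE => ker.
  have r1 : \rank A = 3%N by have := rank_leq_row A; lia.
  (* This rank is at most 3, hence 0 or 3 by [mod4]. If it were 3, convexity would keep the rank at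
     3 for all powers, against nilpotency. *)
  have r2 : \rank (A ^+ 2) = 0%N.
    apply/eqP; apply: contraT => r2_neq0.
    have all3 k : \rank (A ^+ k.+1) = 3%N /\ \rank (A ^+ k.+2) = 3%N.
      elim: k => [|k [IH1 IH2]].
        move: (mod4 2) (power_rank_decr A 1) r2_neq0; rewrite expr1 r1.
        by case: (\rank _) => [|[|[|[|q]]]].
      split=> //; have := power_rank_convex A k.+1.
      by have := power_rank_decr A k.+2; lia.
    by have [] := all3 K; rewrite A0.
  apply: same_ranks_isomorphic AK _ => k.
  rewrite -[RHS]/(power_rank k (N0mx R (n - 1))) N0mx_dsum power_rank_dsum.
  rewrite power_rank_block_subdiag power_rank_zeromx.
  case: k => [|[|k]].
  - by rewrite expr0 mxrank1; lia.
  - by rewrite expr1 r1; lia.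
  - have : (\rank (A ^+ k.+2) <= \rank (A ^+ 2))%N.
      by rewrite -(addn2 k) exprD mxrankM_maxr.
    by rewrite r2; lia.
split.
- move=> M /mem_set /tildeSigmaP [r [m [p [s [l [S oM]]]]]].
  exists M => //; have rkM k := odd_block_power_rank k S oM.
  split.
  + have [K q0] := qrank_eventually0 m p s; apply/lie_nilpotent_aa.
    (* Beyond [K] the [qrank] part vanishes, and beyond [l] so does the term 3. *)
    exists (K + l.+1)%N; apply/eqP; rewrite -mxrank_eq0.
    rewrite -[\rank _]/(power_rank (K + l.+1) (pack M)) rkM q0 ?leq_addr //.
    by rewrite leqNgt addnS ltnS leq_addl.
  + have [a [b qM]] : sq_extends (pack M) := odd_block_extends S oM.
    exact: extension_hypercomplex qM.
  (* The bound on the kernel amounts to rank at least 4, as the size is [4 * n - 1]. *)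
  + have := rkM 1%N; rewrite /power_rank /= expr1 => r1.
    by rewrite dim_kerE r1; have := qrank1_gt0 S; lia.
- move=> M M' /tildeSigmaP [r [m [p [s [l [S oM]]]]]].
  move=> /tildeSigmaP [r' [m' [p' [s' [l' [S' oM']]]]]] eM.
  have iso : lie_isomorphic (almost_abelian M) (almost_abelian M').
    by have : iso_class M M by [exact: lie_isomorphic_refl]; rewrite eM.
  have rk k : (4 * qrank m p s k + 3 * (k <= l) =
               4 * qrank m' p' s' k + 3 * (k <= l'))%N.
    rewrite -(odd_block_power_rank k S oM) -(odd_block_power_rank k S' oM').
    exact: lie_isomorphic_aa_rank.
  (* At the larger of [l] and [l'] the two sides would differ modulo 4. *)
  have ll' : l = l'.
    by have := rk l; have := rk l'; rewrite !leqnn; case: ltngtP; lia.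
  have eq : qrank m p s =1 qrank m' p' s' by move=> k; have := rk k; rewrite ll'; lia.
  rewrite -ll' in oM'; have := odd_block_unique S S' eq oM oM'.
  (* Packed matrices of the same size are equal only if the matrices are, since equality of sizes is
     decidable. *)
  exact: (Eqdep_dec.inj_pair2_eq_dec nat (@eq_comparable nat)).
- move=> _ [A [nilA hcA kerA] <-]; have [K AK A0] := eventually0 _ _ nilA.
  have [mod4 mono] := hypercomplex_rank hcA.
  have [|||M SM rkM] :=
    @tildeSigma_exists R (4 * n - 1) (n - 1) _ _ (power_rank_convex A) A0 mod4 mono.
  - by rewrite expr0 mxrank1.
  - by lia.
  - by move: kerA; rewrite dim_kerE expr1; lia.
  exists M; first exact: set_mem.
  by apply: iso_classP; apply: lie_isomorphic_sym; apply: same_ranks_isomorphic AK _.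
Qed.
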